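(* Let $d\ge1$ and $n\ge0$ be integers. Let $\phi,\psi_1,\dots,\psi_d\in C_b^{n}(\mathbb{R})$ be kernels of order $n$ such that for every $l=1,\dots,n$ the series $$\sum_{k\in\mathbb{Z}}|u-k|^{n}\,|\phi^{(l)}(u-k)|\quad\text{and}\quad\sum_{k\in\mathbb{Z}}|u-k|^{n}\,|\psi_i^{(l)}(u-k)|,\qquad i=1,\dots,d,$$ are uniformly convergent in $u\in\mathbb{R}$. Further, let $f\in C^{n}(\mathbb{R}\times\mathbb{R}^{d})$, let $p\ge0$ be an integer and $\mathbf{q}\in\mathbb{Z}_+^d$ with $p+|\mathbf{q}|\le n$, and suppose $M_{n+1}(\phi)<\infty$ and $M_{n+1}(\psi_i)<\infty$ for $i=1,\dots,d$. Then for every $w>0$, writing $N_{a,\mathbf{b}}=n-(p+|\mathbf{q}|-a-|\mathbf{b}|)$, $$\begin{aligned}\big\|\partial^{(p,\mathbf{q})}K_{n,w}^{\phi,\psi}f-\partial^{(p,\mathbf{q})}f\big\|_\infty\le{}&\frac{1}{w^{n-(p+|\mathbf{q}|)}}\sum_{a=0}^{p}\ \sum_{\mathbf{0}\le\mathbf{b}\le\mathbf{q}}\binom{p}{a}\binom{\mathbf{q}}{\mathbf{b}}2^{N_{a,\mathbf{b}}-(d+1)}\sum_{l+|\mathbf{j}|=N_{a,\mathbf{b}}}\frac{1}{l!\,\mathbf{j}!}\\&\times\omega\Big(\partial^{(l+p-a,\ \mathbf{j}+\mathbf{q}-\mathbf{b})}f,\tfrac1w,\tfrac1w,\dots,\tfrac1w\Big)\\&\times\big(M_{l+1}(\phi^{(a)})+2M_l(\phi^{(a)})+M_1(\phi^{(a)})+2M_0(\phi^{(a)})\big)\\&\times\prod_{i=1}^{d}\big(M_{j_i+1}(\psi_i^{(b_i)})+2M_{j_i}(\psi_i^{(b_i)})+M_1(\psi_i^{(b_i)})+2M_0(\psi_i^{(b_i)})\big),\end{aligned}$$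 where $a,l\ge 0$ are integers and $\mathbf{b},\mathbf{j}\in\mathbb{Z}_+^d$.
   Context: Notation. For multi-indices $\mathbf{j},\mathbf{b}\in\mathbb{Z}_+^d$ (non-negative integer entries): $|\mathbf{j}|=j_1+\dots+j_d$, $\mathbf{j}!=\prod_i j_i!$, $\mathbf{b}\le\mathbf{q}$ means $b_i\le q_i$ for all $i$, $\binom{\mathbf{q}}{\mathbf{b}}=\frac{\mathbf{q}!}{\mathbf{b}!(\mathbf{q}-\mathbf{b})!}$, and $\mathbf{x}^{\mathbf{j}}=\prod_i x_i^{j_i}$ for $\mathbf{x}\in\mathbb{R}^d$; $0^0=1$. Points of $\mathbb{R}\times\mathbb{R}^d$ are written $(x,\mathbf{y})$; $\partial^{(l,\mathbf{j})}f=\frac{\partial^{l+|\mathbf{j}|}f}{\partial x^l\partial y_1^{j_1}\cdots\partial y_d^{j_d}}$; $\|f\|_\infty=\sup|f|$ over $\mathbb{R}\times\mathbb{R}^d$. Function spaces. $C(\mathbb{R}\times\mathbb{R}^d)$ is the space of uniformly continuous bounded real functions. $C^{n}(\mathbb{R}\times\mathbb{R}^d)$ is the space of $n$-times continuously differentiable real functions all of whose partial derivatives of order exactly $n$ belong to $C(\mathbb{R}\times\mathbb{R}^d)$. $C_b^{n}(\mathbb{R})$ is the space of $n$-times continuously differentiable real functions on $\mathbb{R}$ whose derivatives of order at most $n$ are bounded and continuous. Modulus of continuity. For $g\in C(\mathbb{R}\times\mathbb{R}^d)$ and $\delta,\gamma_1,\dots,\gamma_d>0$, $$\omega(g,\delta,\gamma_1,\dots,\gamma_d)=\sup\{|g(x,\mathbf{y})-g(t,\mathbf{s})|:\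 |x-t|<\delta,\ |y_i-s_i|<\gamma_i,\ i=1,\dots,d\}.$$ Uniform convergence of moment series. For $g:\mathbb{R}\to\mathbb{R}$, the series $\sum_{k\in\mathbb{Z}}|u-k|^{n}|g(u-k)|$ is called uniformly convergent in $u\in\mathbb{R}$ if it converges for every $u$ and $\lim_{R\to\infty}\sup_{u\in\mathbb{R}}\sum_{k\in\mathbb{Z},\,|u-k|\ge R}|u-k|^{n}|g(u-k)|=0$. Kernels and moments. For $\chi:\mathbb{R}\to\mathbb{R}$ and $\beta\ge0$ put $M_\beta(\chi)=\sup_{u\in\mathbb{R}}\sum_{k\in\mathbb{Z}}|u-k|^{\beta}|\chi(u-k)|\in[0,\infty]$; the right-hand side of the estimate is read in $[0,\infty]$ with $0\cdot\infty=0$. The function $\chi$ is a kernel of order $n$ if (i) $\sum_{k\in\mathbb{Z}}\chi(u-k)=1$ for every $u\in\mathbb{R}$; (ii) the series $\sum_{k\in\mathbb{Z}}|u-k|^{n}|\chi(u-k)|$ is uniformly convergent in $u\in\mathbb{R}$, i.e. it converges for every $u$ and $\lim_{R\to\infty}\sup_{u\in\mathbb{R}}\sum_{k\in\mathbb{Z},\,|u-k|\ge R}|u-k|^{n}|\chi(u-k)|=0$, and $M_\beta(\chi)<\infty$ for all $0\le\beta\le n$. Operator. For $w>0$, $k\in\mathbb{Z}$, $\mathbf{m}\in\mathbb{Z}^d$ let $I_k^w=[\frac{k}{w},\frac{k+1}{w}]$ and $I_{\mathbf{m}}^w=\prod_{i=1}^d[\frac{m_i}{w},\frac{m_i+1}{w}]$.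 The Hermite-type sampling Kantorovich operator is $$K_{n,w}^{\phi,\psi}f(x,\mathbf{y})=\sum_{k\in\mathbb{Z}}\sum_{\mathbf{m}\in\mathbb{Z}^d}\phi(wx-k)\prod_{i=1}^d\psi_i(wy_i-m_i)\left(\sum_{l+|\mathbf{j}|\le n}\frac{1}{l!\,\mathbf{j}!}\,w^{d+1}\int_{I_k^w}\int_{I_{\mathbf{m}}^w}\frac{\partial^{l+|\mathbf{j}|}f(u,\mathbf{v})}{\partial u^l\partial\mathbf{v}^{\mathbf{j}}}(x-u)^l(\mathbf{y}-\mathbf{v})^{\mathbf{j}}\,d\mathbf{v}\,du\right),$$ where the inner sum is over integers $l\ge0$ and $\mathbf{j}\in\mathbb{Z}_+^d$. *)

(* Defs.v *)
From mathcomp Require Import all_boot all_order all_algebra.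
From mathcomp Require Import all_classical all_reals all_analysis.
From mathcomp Require summability.

Set Implicit Arguments.
Unset Strict Implicit.
Unset Printing Implicit Defensive.

Import Order.TTheory GRing.Theory Num.Theory.
Import numFieldNormedType.Exports.

Local Open Scope classical_set_scope.
Local Open Scope ring_scope.

(* A point (x, y) of R x R^d is z : R * 'rV[R]_d, with x = z.1 and
   y_i = z.2 0 i. The coordinates are indexed by option 'I_d: None is x and
   Some i is y_i. *)
Definition axis (R : realType) (d : nat) (c : option 'I_d) : R * 'rV[R]_d :=
  if c is Some i then (0, delta_mx 0 i) else (1, 0).

(* The head of s is the derivative taken last. *)
Definition partials (R : realType) (d : nat) (s : seq (option 'I_d))
    (f : R * 'rV[R]_d -> R) : R * 'rV[R]_d -> R :=
  foldr (fun c (g : R * 'rV[R]_d -> R) => 'D_(axis R c) g) f s.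

(* 'D_v is a total operator with an arbitrary value where the limit does not
   exist; this says that every derivative taken in [partials s f] exists. *)
Definition has_partials (R : realType) (d : nat) (s : seq (option 'I_d))
    (f : R * 'rV[R]_d -> R) : Prop :=
  forall c t, suffix (c :: t) s ->
    forall z : R * 'rV[R]_d, derivable (partials t f) z (axis R c).

(* d/dx (l times), then d/dy_1 (j_1 times), ..., d/dy_d (j_d times), read from
   left to right as in the fraction notation, so that x is differentiated last. *)
Definition mdirs (d l : nat) (j : 'I_d -> nat) : seq (option 'I_d) :=
  nseq l None ++ flatten [seq nseq (j i) (Some i) | i <- enum 'I_d].

Definition mpartial (R : realType) (d l : nat) (j : 'I_d -> nat)
    (f : R * 'rV[R]_d -> R) : R * 'rV[R]_d -> R :=
  partials (mdirs l j) f.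

Definition mfact (d : nat) (j : 'I_d -> nat) : nat := (\prod_(i < d) (j i)`!)%N.

Definition mbinom (R : realType) (d : nat) (q b : 'I_d -> nat) : R :=
  (mfact q)%:R / ((mfact b)%:R * (mfact (fun i => q i - b i)%N)%:R).

Definition sup_norm (R : realType) (d : nat) (g : R * 'rV[R]_d -> R) : \bar R :=
  ereal_sup [set `|g z|%:E | z in setT].

Definition in_C (R : realType) (d : nat) (g : R * 'rV[R]_d -> R) : Prop :=
  unif_continuous g /\ bounded_fun g.

(* Only the derivatives of order exactly n are required to be bounded and
   uniformly continuous. *)
Definition in_Cn (R : realType) (d n : nat) (f : R * 'rV[R]_d -> R) : Prop :=
  (forall s : seq (option 'I_d), (size s <= n)%N ->
     has_partials s f /\ continuous (partials s f)) /\
  (forall s : seq (option 'I_d), size s = n -> in_C (partials s f)).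

Definition in_Cbn (R : realType) (n : nat) (g : R -> R) : Prop :=
  (forall l, (l < n)%N -> forall x : R, derivable (derive1n l g) x 1) /\
  (forall l, (l <= n)%N -> continuous (derive1n l g) /\ bounded_fun (derive1n l g)).

Definition modulus (R : realType) (d : nat) (g : R * 'rV[R]_d -> R)
    (delta : R) (gamma : 'I_d -> R) : \bar R :=
  ereal_sup [set e | exists z t : R * 'rV[R]_d,
    [/\ `|z.1 - t.1| < delta,
        forall i, `|z.2 0 i - t.2 0 i| < gamma i
      & e = `|g z - g t|%:E]].

Definition unif_moment_series (R : realType) (n : nat) (g : R -> R) : Prop :=
  (forall u : R, (\esum_(k in [set: int])
     (`|u - k%:~R| ^+ n * `|g (u - k%:~R)|)%:E < +oo)%E) /\
  (fun r : R => ereal_sup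
     [set \esum_(k in [set k : int | r <= `|u - k%:~R|])
        (`|u - k%:~R| ^+ n * `|g (u - k%:~R)|)%:E | u in [set: R]])
    @ +oo --> 0%E.

(* powR has 0 `^ 0 = 1. *)
Definition abs_moment (R : realType) (beta : R) (chi : R -> R) : \bar R :=
  ereal_sup [set \esum_(k in [set: int])
    (`|u - k%:~R| `^ beta * `|chi (u - k%:~R)|)%:E | u in [set: R]].

(* Series of reals over a countable index set are unconditional: the limit is
   taken along the finite sets of indices directed by inclusion. *)
Definition kernel_of_order (R : realType) (n : nat) (chi : R -> R) : Prop :=
  [/\ forall u : R,
        summability.partial_sum (fun k : int => chi (u - k%:~R))
          @ summability.totally --> (1 : R),
      unif_moment_series n chi
    & forall beta : R, 0 <= beta <= n%:R -> (abs_moment beta chi < +oo)%E].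

Definition cell (R : realType) (w : R) (k : int) : set R :=
  `[k%:~R / w, (k + 1)%:~R / w].

(* Integral over the product of the cells, as the iterated integral over
   v_1, ..., v_d, v_1 being outermost; the base point 0 is irrelevant since each
   of its coordinates is replaced. It is only applied to continuous integrands,
   for which it is the d-dimensional Lebesgue integral. *)
Definition box_integral (R : realType) (d : nat) (w : R) (m : 'I_d -> int)
    (g : 'rV[R]_d -> R) : R :=
  foldr (fun i (h : 'rV[R]_d -> R) (v : 'rV[R]_d) =>
           \int[lebesgue_measure]_(t in cell w (m i))
             h (\row_j if j == i then t else v 0 j))
        g (enum 'I_d) 0.

(* Multi-indices of weight at most n have entries at most n, so they are
   enumerated by {ffun 'I_d -> 'I_n.+1}. *)
Definition hermite_term (R : realType) (d n : nat) (phi : R -> R)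
    (psi : 'I_d -> R -> R) (w : R) (f : R * 'rV[R]_d -> R)
    (z : R * 'rV[R]_d) (km : int * {ffun 'I_d -> int}) : R :=
  phi (w * z.1 - km.1%:~R) *
  (\prod_(i < d) psi i (w * z.2 0 i - (km.2 i)%:~R)) *
  (\sum_(l < n.+1)
   \sum_(j : {ffun 'I_d -> 'I_n.+1} | (l + \sum_(i < d) j i <= n)%N)
     1 / ((l`!)%:R * (mfact (fun i => j i))%:R) * w ^+ d.+1 *
     \int[lebesgue_measure]_(u in cell w km.1)
       box_integral w km.2 (fun v =>
         mpartial l (fun i => j i) f (u, v) * (z.1 - u) ^+ l *
         \prod_(i < d) (z.2 0 i - v 0 i) ^+ j i)).

Definition hermite_kantorovich (R : realType) (d n : nat) (phi : R -> R)
    (psi : 'I_d -> R -> R) (w : R) (f : R * 'rV[R]_d -> R) :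
    R * 'rV[R]_d -> R :=
  fun z => summability.sum (hermite_term n phi psi w f z : _ -> R).

Definition moment_factor (R : realType) (l : nat) (chi : R -> R) : \bar R :=
  (abs_moment l.+1%:R chi + 2%:E * abs_moment l%:R chi
   + abs_moment 1 chi + 2%:E * abs_moment 0 chi)%E.

(* Main.v *)
Require Import Defs.
From mathcomp Require Import all_boot all_order all_algebra.
From mathcomp Require Import all_classical all_reals all_analysis.
From mathcomp Require Import finmap ring lra zify.
From mathcomp Require summability.

(** The operator applied to [f] at [z] is a weighted sum, over the lattice of
    cells, of the Taylor polynomials of [f] at the points [xi] of the cell,
    averaged over the cell and evaluated at [z]; the weight of the cell [i] is
    the product over the directions [c] of [chi c (w z_c - i_c)], where [chi]
    gathers [phi] and the [psi i].

    Two facts about Taylor polynomials carry the proof. First, a partial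
    derivative in [z] of the Taylor polynomial of [D^g f], of total order [n],
    is the Taylor polynomial of the corresponding derivative of [D^g f]
    ([is_derive_cell_taylor]). Since the weights differentiate to weights with
    derived kernels, the derivative of order [q] of the operator is given by the
    Leibniz rule

      D^q (K f) = sum_(b <= q) binom(q, b) w^|b| K_(b, q - b),

    where [K_(b, g)] is the operator with kernels derived [b] times and with the
    averaged Taylor polynomials of [D^g f] ([is_derive_leibniz]). Termwise
    differentiation is legitimate because all the moment series converge
    uniformly, although not always normally ([is_derive_unconditional_sum],
    [sk_term_tail]).

    Second, the remainder [D^g f z - Taylor] is bounded by the monomials of
    degree [n - |g|] in [z - xi] times the oscillation of the derivatives of
    order [n] along the segment from [xi] to [z] ([taylor_remainder]). The main
    term [D^g f z] does not depend on the cell, so it is multiplied by the sum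
    of the derived weights, which is [1] for [b = 0] and [0] otherwise
    ([weight_sum]): the error is exactly the weighted sum of the remainders
    ([sk_op_error]).

    It remains to estimate. Write [t_c = |w z_c - i_c|]. On the cell
    [w |z_c - xi_c| <= 1 + t_c]; the oscillation is at most
    [prod_c (2 + t_c)] times the modulus of continuity with steps [1 / w]
    ([modulus_segment]); and
    [(1 + t)^l (2 + t) <= 2^(l - 1) (t^(l + 1) + 2 t^l + t + 2)] by convexity,
    which produces the four moments of the estimate and the factor
    [2^(N - (d + 1))] ([moment_factor_bound], [sk_op_error_bound]). The sum over
    the lattice of a product over the directions is at most the product of the
    one-dimensional sums ([lattice_sum_le_prod]).

    All the directions are treated alike: a point of [R * 'rV_d] is seen through
    its coordinates indexed by [option 'I_d], and multi-indices are functions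
    [option 'I_d -> nat]. *)

Set Implicit Arguments.
Unset Strict Implicit.
Unset Printing Implicit Defensive.

Import Order.TTheory GRing.Theory Num.Theory.
Import numFieldNormedType.Exports.

Local Open Scope classical_set_scope.
Local Open Scope ring_scope.

#[local] Existing Instance summability.totally_filter.

(** * Directional derivatives and the mean value theorem *)

(** The difference quotient multiplied out: this form makes sense at [h = 0] and
    survives limits and sums. *)
Lemma is_derive_epsP (R : realType) (V : normedModType R) (g : V -> R)
    (z v : V) (d : R) :
  is_derive z v g d <->
  forall e : R, 0 < e -> exists2 r : R, 0 < r & forall h : R, `|h| < r ->
    `|g (z + h *: v) - g z - h * d| <= e * `|h|.
Proof.
have E h : h != 0 -> `|h^-1 *: (g (h *: v + z) - g z) - d| * `|h|
    = `|g (z + h *: v) - g z - h * d|.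
  move=> h0; rewrite -normrM mulrBl [_ *: _]mulrC -mulrA mulVf // mulr1.
  by rewrite [d * h]mulrC [in LHS](addrC _ z).
split.
- case=> dg dgE e e0.
  have /cvgrPdist_le : (fun h => h^-1 *: ((g \o shift z) (h *: v) - g z)) @ 0^' --> d.
    by rewrite -dgE; exact: dg.
  move=> /(_ _ e0); rewrite near_withinE -nbhs_nearE => /nbhs_ballP [r /= r0 H].
  exists r => // h hr; have [->|h0] := eqVneq h 0.
    by rewrite scale0r addr0 subrr sub0r mul0r oppr0 normr0 mulr0.
  rewrite -E // ler_wpM2r // distrC.
  by apply: (H h) => //; rewrite /ball /= sub0r normrN.
- move=> H.
  suff C : (fun h => h^-1 *: ((g \o shift z) (h *: v) - g z)) @ 0^' --> d.
    by apply: DeriveDef; [apply/cvg_ex; exists d|exact: (cvg_lim _ C)].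
  apply/cvgrPdist_le => e e0; rewrite near_withinE -nbhs_nearE.
  have [r r0 Hr] := H _ e0.
  apply/nbhs_ballP; exists r => // h; rewrite /ball /= sub0r normrN => hr h0.
  rewrite distrC -(ler_pM2r (x := `|h|)) ?normr_gt0 // E //.
  exact: Hr.
Qed.

(** Reduces directional derivatives to derivatives of functions of one real
    variable, at every point of the line and not only at its origin. *)
Lemma is_derive_lineP (R : realType) (V : normedModType R) (g : V -> R)
    (z v : V) (t d : R) :
  is_derive (z + t *: v) v g d <->
  is_derive t (1 : R) (fun s => g (z + s *: v)) d.
Proof.
rewrite (is_derive_epsP g) is_derive_epsP.
by split=> H e /H [r r0 Hr]; exists r => // h /Hr;
  rewrite [h *: 1]mulr1 scalerDl addrA.
Qed.

Section MeanValue.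
Context {R : realType}.
Variables (f df : R -> R).
Hypothesis Hf : forall x, is_derive x (1 : R) f (df x).

Lemma is_derive_continuous : continuous f.
Proof.
move=> x; apply: differentiable_continuous; apply/derivable1_diffP.
by case: (Hf x).
Qed.

Lemma mean_value_increment (a h : R) :
  exists2 s : R, `|s| <= `|h| & f (a + h) - f a = df (a + s) * h.
Proof.
have C a' b' : {within `[a', b'], continuous f}.
  exact/continuous_subspaceT/is_derive_continuous.
have [h0|h0] := leP 0 h.
- have ab : a <= a + h by rewrite lerDl.
  have [c + E] := MVT_segment ab (fun x _ => Hf x) (C _ _).
  rewrite in_itv /= => /andP [c1 c2]; exists (c - a); last first.
    have -> : a + (c - a) = c by rewrite addrC subrK.
    by rewrite E; ring.
  by rewrite !ger0_norm // ?subr_ge0 // lerBlDl.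
- have ab : a + h <= a by rewrite gerDl ltW.
  have [c + E] := MVT_segment ab (fun x _ => Hf x) (C _ _).
  rewrite in_itv /= => /andP [c1 c2]; exists (c - a); last first.
    have -> : a + (c - a) = c by rewrite addrC subrK.
    by rewrite -[LHS]opprB E; ring.
  by rewrite !ler0_norm ?subr_le0 // ?(ltW h0) //; lra.
Qed.

End MeanValue.

(** The mean value theorem for [g - f] and [g + f]. *)
Lemma le_norm_of_derive (R : realType) (f df g dg : R -> R) :
  (forall x, is_derive x (1 : R) f (df x)) ->
  (forall x, is_derive x (1 : R) g (dg x)) ->
  (forall x, 0 <= x <= 1 -> `|df x| <= dg x) ->
  f 0 = 0 -> g 0 = 0 -> forall t, 0 <= t <= 1 -> `|f t| <= g t.
Proof.
move=> Hf Hg le f0 g0 t /andP [t0 t1].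
have key (h dh : R -> R) : (forall x, is_derive x (1 : R) h (dh x)) ->
    h 0 = 0 -> (forall x, 0 <= x <= 1 -> 0 <= dh x) -> 0 <= h t.
  move=> Hh h0 dh0.
  have [c + E] := MVT_segment t0 (fun x _ => Hh x)
    (continuous_subspaceT (is_derive_continuous Hh)).
  rewrite in_itv /= => /andP [c0 c1].
  rewrite h0 !subr0 in E; rewrite E mulr_ge0 // dh0 // c0 /=.
  exact: le_trans t1.
rewrite ler_norml; apply/andP; split.
- rewrite -subr_ge0 opprK.
  apply: (key (f + g) (df + dg) (fun x => is_deriveD (Hf x) (Hg x))) => [|x /le].
  + by change (f 0 + g 0 = 0); rewrite f0 g0 addr0.
  + by rewrite ler_norml => /andP [+ _]; change (- dg x <= df x -> 0 <= df x + dg x); lra.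
- rewrite -subr_ge0.
  apply: (key (g - f) (dg - df) (fun x => is_deriveB (Hg x) (Hf x))) => [|x /le].
  + by change (g 0 - f 0 = 0); rewrite f0 g0 subrr.
  + by rewrite ler_norml => /andP [_]; change (df x <= dg x -> 0 <= dg x - df x); lra.
Qed.

(** * Coordinates, derivatives along lines, symmetry of derivatives *)

Section Coordinates.
Context {R : realType} {d : nat}.
Local Notation C := (option 'I_d).
Local Notation V := (R * 'rV[R]_d)%type.
Implicit Types (z v : V) (c : C) (t e r h : R).

Definition coord z c : R := if c is Some i then z.2 0 i else z.1.

Lemma coordD z v c : coord (z + v) c = coord z c + coord v c.
Proof. by case: c => [i|] //=; rewrite mxE. Qed.

Lemma coordN z c : coord (- z) c = - coord z c.
Proof. by case: c => [i|] //=; rewrite mxE. Qed.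

Lemma coordB z v c : coord (z - v) c = coord z c - coord v c.
Proof. by rewrite coordD coordN. Qed.

Lemma coordZ t z c : coord (t *: z) c = t * coord z c.
Proof. by case: c => [i|] //=; rewrite mxE. Qed.

Lemma coord_axis c c' : coord (axis R c) c' = (c == c')%:R.
Proof.
by case: c => [i|]; case: c' => [j|] //=; rewrite mxE ?eqxx //= eq_sym.
Qed.

Lemma coord0 c : coord 0 c = 0.
Proof. by case: c => [i|] //=; rewrite mxE. Qed.

Lemma eq_coord z v : (forall c, coord z c = coord v c) -> z = v.
Proof.
case: z v => [x y] [x' y'] H; congr pair; first exact: (H None).
by apply/rowP => i; exact: (H (Some i)).
Qed.

Lemma coord_shift z c t c' :
  coord (z + t *: axis R c) c' = coord z c' + t * (c == c')%:R.
Proof. by rewrite coordD coordZ coord_axis. Qed.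

Lemma ball_coordP z (e : R) v : 0 < e ->
  ball z e v <-> forall c, `|coord z c - coord v c| < e.
Proof.
move=> e0; split=> [[/= H1 H2] [i|]|H]; [exact: (H2.2 0 i)|exact: H1|].
split; first exact: (H None).
by split=> // i j; rewrite (ord1 i); exact: (H (Some j)).
Qed.

(** The topology of the space is that of coordinatewise closeness; this spares
    all reasoning on the product norm. *)
Lemma near_coordP z (P : V -> Prop) :
  (\forall v \near z, P v) <->
  exists2 e : R, 0 < e & forall v, (forall c, `|coord v c - coord z c| < e) -> P v.
Proof.
rewrite -nbhs_nearE; split.
  move/nbhs_ballP => [e /= e0 H]; exists e => // v Hv; apply: H.
  by apply/ball_coordP => // c; rewrite distrC.
move=> [e e0 H]; apply/nbhs_ballP; exists e => // v /ball_coordP Hv.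
by apply: H => c; rewrite distrC; apply: Hv.
Qed.

Lemma continuous_coord c : continuous (coord ^~ c).
Proof.
move=> z; apply/cvgrPdist_lt => e e0; apply/near_coordP.
by exists e => // v /(_ c); rewrite distrC.
Qed.

Lemma sum_axis v : v = \sum_c coord v c *: axis R c.
Proof.
apply: eq_coord => c.
have E : {morph coord ^~ c : x y / x + y} by move=> x y; exact: coordD.
rewrite (big_morph _ E (coord0 c)) (bigD1 c) //= big1 ?addr0 => [|c' cc'].
  by rewrite coordZ coord_axis eqxx mulr1.
by rewrite coordZ coord_axis (negbTE cc') mulr0.
Qed.

Section ContinuousPartials.
Variables (g : V -> R) (dg : C -> V -> R).
Hypothesis Hg : forall c z, is_derive z (axis R c) g (dg c z).
Hypothesis Hdg : forall c, continuous (dg c).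

Lemma partial_increment c z h :
  exists2 s : R, `|s| <= `|h| &
    g (z + h *: axis R c) - g z = dg c (z + s *: axis R c) * h.
Proof.
have D (x : R) : is_derive x (1 : R) (fun s => g (z + s *: axis R c))
    (dg c (z + x *: axis R c)).
    exact: (is_derive_lineP g z (axis R c) x _).1 (Hg _ _).
have [s sh] := mean_value_increment D 0 h.
by rewrite !add0r scale0r addr0 => E; exists s.
Qed.

(** Coordinates are changed one after the other, each change being controlled by
    the mean value theorem; the base point [z'] is allowed to move so that the
    estimate can be iterated. *)
Lemma partial_increments (s : seq C) (v z : V) e : 0 < e ->
  exists2 r : R, 0 < r & forall h z', `|h| < r ->
    (forall c, `|coord z' c - coord z c| < r) ->
    `|g (z' + h *: \sum_(c <- s) coord v c *: axis R c) - g z'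
      - h * \sum_(c <- s) coord v c * dg c z| <= e * `|h|.
Proof.
elim: s e => [|c s IH] e e0.
  exists 1 => // h z' _ _; rewrite !big_nil scaler0 addr0 subrr mulr0 subr0.
  by rewrite normr0 mulr_ge0 // ltW.
have e2 : 0 < e / 2 by rewrite divr_gt0.
have [r r0 Hr] := IH _ e2.
have [M M0 M1] : exists2 M : R, 0 < M & `|coord v c| <= M.
  by exists (`|coord v c| + 1); rewrite ?ltr_wpDl ?lerDl.
have : \forall y \near z, `|dg c z - dg c y| < e / 2 / M.
  by move: (@Hdg c z) => /cvgrPdist_lt; apply; rewrite divr_gt0.
rewrite near_coordP => -[q q0 Hq].
have [B B0 B1] : exists2 B : R, 0 < B & forall c',
    `|coord (\sum_(c <- s) coord v c *: axis R c) c'| <= B.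
  exists (1 + \sum_c' `|coord (\sum_(c <- s) coord v c *: axis R c) c'|).
    by rewrite ltr_pwDl // sumr_ge0.
  by move=> c'; rewrite (bigD1 c') //= addrCA lerDl addr_ge0 // sumr_ge0.
have D0 : 0 < 1 + B + M by rewrite addr_gt0 // addr_gt0.
(* [z' + h *: S + t *: axis R c] is within [`|h| * (1 + B + M)] of [z]. *)
pose u := Num.min r (q / (1 + B + M)).
have u0 : 0 < u by rewrite lt_min r0 divr_gt0.
exists u => // h z' hu Hz'.
rewrite !big_cons scalerDr.
set S := \sum_(j <- s) _ *: _; set T := \sum_(j <- s) _.
rewrite (addrC (h *: _) (h *: S)) scalerA addrA.
have [t ht Et] := partial_increment c (z' + h *: S) (h * coord v c).
have hur : `|h| < r by apply: lt_le_trans hu _; rewrite ge_min lexx.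
have := Hr h z' hur _.
have H1 : forall c', `|coord z' c' - coord z c'| < r.
  by move=> c'; apply: lt_le_trans (Hz' c') _; rewrite ge_min lexx.
move=> /(_ H1); rewrite -/S -/T => H2.
have H3 : `|dg c z - dg c (z' + h *: S + t *: axis R c)| < e / 2 / M.
  apply: Hq => c'; rewrite coord_shift coordD coordZ.
  have uq : u * (1 + B + M) <= q by rewrite -ler_pdivlMr // ge_min lexx orbT.
  apply: lt_le_trans uq.
  have -> : coord z' c' + h * coord S c' + t * (c == c')%:R - coord z c' =
    (coord z' c' - coord z c') + h * coord S c' + t * (c == c')%:R by ring.
  apply: le_lt_trans (ler_normD _ _) _.
  apply: le_lt_trans (lerD (ler_normD _ _) (lexx _)) _.
  rewrite !mulrDr mulr1.
  apply: ltr_leD; first apply: ltr_leD; first exact: Hz'.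
    by rewrite normrM ler_pM // ?(ltW hu) // B1.
  rewrite normrM (le_trans (y := `|t|)) //.
    by rewrite ler_piMr //; case: (c == c'); rewrite ?normr1 ?normr0.
  by apply: le_trans ht _; rewrite normrM ler_pM // ?(ltW hu).
have -> : g (z' + h *: S + (h * coord v c) *: axis R c) - g z' -
    h * (coord v c * dg c z + T) =
  (g (z' + h *: S) - g z' - h * T)
   - (h * coord v c) * (dg c z - dg c (z' + h *: S + t *: axis R c)).
  have -> : g (z' + h *: S + (h * coord v c) *: axis R c) = g (z' + h *: S) +
    dg c (z' + h *: S + t *: axis R c) * (h * coord v c).
    by rewrite -Et; ring.
  by ring.
apply: le_trans (ler_normB _ _) _.
rewrite [e]splitr mulrDl lerD // normrM normrM mulrC.
rewrite mulrA (mulrC _ `|h|) [leRHS]mulrC -mulrA ler_wpM2l //.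
have : `|dg c z - dg c (z' + h *: S + t *: axis R c)| * M <= e / 2.
  by rewrite -ler_pdivlMr // ltW.
by apply: le_trans; rewrite ler_wpM2l.
Qed.

(** Continuous partial derivatives imply differentiability; what is needed of it
    is the chain rule along a line. *)
Lemma is_derive_line z v (t : R) :
  is_derive t (1 : R) (fun s => g (z + s *: v))
    (\sum_c coord v c * dg c (z + t *: v)).
Proof.
apply: (is_derive_lineP g z v t _).1; apply/is_derive_epsP => e e0.
have [r r0 Hr] := partial_increments (index_enum C) v (z + t *: v) e0.
exists r => // h hr; have := Hr h (z + t *: v) hr; rewrite -sum_axis; apply.
by move=> c; rewrite subrr normr0.
Qed.

End ContinuousPartials.

(** Symmetry of second derivatives: both are limits of the same second-order
    difference quotient. *)
Lemma mixed_partials_comm (g ga gb gab gba : V -> R) (a b : C) :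
  (forall z, is_derive z (axis R a) g (ga z)) ->
  (forall z, is_derive z (axis R b) g (gb z)) ->
  (forall z, is_derive z (axis R b) ga (gba z)) ->
  (forall z, is_derive z (axis R a) gb (gab z)) ->
  continuous gba -> continuous gab -> gba = gab.
Proof.
(* The second-order difference at z with steps h, h is h ^ 2 times a mixed
   derivative at a point whose coordinates are within 2 h of those of z. *)
have key (f fa fba : V -> R) (c c' : C) :
    (forall z, is_derive z (axis R c) f (fa z)) ->
    (forall z, is_derive z (axis R c') fa (fba z)) ->
    forall z h, exists2 y, (forall c, `|coord y c - coord z c| <= `|h| + `|h|) &
    f (z + h *: axis R c + h *: axis R c') - f (z + h *: axis R c)
      - (f (z + h *: axis R c') - f z) = fba y * h * h.
  move=> Hf Hfa z h.
  pose F (s : R) := f (z + h *: axis R c' + s *: axis R c) - f (z + s *: axis R c).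
  pose dF (s : R) := fa (z + h *: axis R c' + s *: axis R c) - fa (z + s *: axis R c).
  have HF (s : R) : is_derive s (1 : R) F (dF s).
    apply: is_deriveB; first exact: (is_derive_lineP f _ _ _ _).1 (Hf _).
    exact: (is_derive_lineP f _ _ _ _).1 (Hf _).
  have [s sh] := mean_value_increment HF 0 h.
  rewrite !add0r /F /dF scale0r !addr0 => E.
  have HG (x : R) : is_derive x (1 : R)
      (fun x => fa (z + s *: axis R c + x *: axis R c'))
      (fba (z + s *: axis R c + x *: axis R c')).
    exact: (is_derive_lineP fa _ _ _ _).1 (Hfa _).
  have [x xh] := mean_value_increment HG 0 h.
  rewrite !add0r scale0r addr0 => E'.
  exists (z + s *: axis R c + x *: axis R c') => [c0|].
    rewrite !coord_shift.
    have -> (p q r : R) : p + q + r - p = q + r by ring.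
    apply: le_trans (ler_normD _ _) _; apply: lerD; rewrite normrM.
      by apply: le_trans sh; rewrite ler_piMr //; case: eqP; rewrite ?normr1 ?normr0.
    by apply: le_trans xh; rewrite ler_piMr //; case: eqP; rewrite ?normr1 ?normr0.
  rewrite -E'.
  have -> : z + s *: axis R c + h *: axis R c' = z + h *: axis R c' + s *: axis R c.
    by rewrite addrAC.
  rewrite -E (addrAC z (h *: axis R c') (h *: axis R c)); ring.
move=> Ha Hb Hba Hab cba cab; apply/funext => z; apply/eqP.
rewrite -subr_eq0 -normr_le0; apply/ler_addgt0Pr => e e0; rewrite add0r.
have e2 : 0 < e / 2 by rewrite divr_gt0.
have : \forall y \near z, `|gba z - gba y| < e / 2.
  by move: (cba z) => /cvgrPdist_lt; apply.
have : \forall y \near z, `|gab z - gab y| < e / 2.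
  by move: (cab z) => /cvgrPdist_lt; apply.
rewrite !near_coordP => -[r r0 Hr] [q q0 Hq].
pose h := Num.min r q / 3.
have m0 : 0 < Num.min r q by rewrite lt_min r0.
have h0 : 0 < h by rewrite divr_gt0.
have hh : `|h| + `|h| < Num.min r q by rewrite gtr0_norm // /h; lra.
have [y1 Hy1 E1] := key _ _ _ _ _ Ha Hba z h.
have [y2 Hy2 E2] := key _ _ _ _ _ Hb Hab z h.
have E : gba y1 = gab y2.
  have : gba y1 * h * h = gab y2 * h * h.
    by rewrite -E1 -E2 (addrAC z); ring.
  by move/(mulIf (lt0r_neq0 h0))/(mulIf (lt0r_neq0 h0)).
have B1 : `|gba z - gba y1| < e / 2.
  by apply: Hq => c; apply: le_lt_trans (Hy1 c) _; apply: lt_le_trans hh _;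
    rewrite ge_min lexx orbT.
have B2 : `|gab z - gab y2| < e / 2.
  by apply: Hr => c; apply: le_lt_trans (Hy2 c) _; apply: lt_le_trans hh _;
    rewrite ge_min lexx.
have -> : gba z - gab z = (gba z - gba y1) - (gab z - gab y2) by rewrite E; ring.
by apply: le_trans (ler_normB _ _) _; rewrite [e]splitr; apply: lerD; exact: ltW.
Qed.

End Coordinates.

(** * Multi-indices and sums over them *)

Section MultiIndices.
Context {d : nat}.
Local Notation C := (option 'I_d).
Local Notation mindex := (C -> nat).
Implicit Types (a b q : mindex) (c : C).

Definition msize a : nat := (\sum_c a c)%N.
Definition mfac a : nat := (\prod_c (a c)`!)%N.
Definition mbin q b : nat := (\prod_c 'C(q c, b c))%N.
Definition minc c a : mindex := fun c' => (a c' + (c == c'))%N.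
Definition mdec c a : mindex := fun c' => (a c' - (c == c'))%N.
Definition madd a b : mindex := fun c => (a c + b c)%N.
Definition msub a b : mindex := fun c => (a c - b c)%N.
Definition mzero : mindex := fun=> 0%N.
(** The index of the mixed derivative of order [l] in [x] and [j i] in [y_i]. *)
Definition mindex_of (l : nat) (j : 'I_d -> nat) : mindex :=
  fun c => if c is Some i then j i else l.

Lemma big_option (S : Type) (idx : S) (op : Monoid.com_law idx) (F : C -> S) :
  \big[op/idx]_c F c = op (F None) (\big[op/idx]_(i < d) F (Some i)).
Proof.
rewrite (bigD1 None) //=; congr (op _ _).
rewrite (reindex_omap (@Some 'I_d) id) => [|[i|]] //=.
by apply: eq_bigl => i; rewrite eqxx.
Qed.

Lemma mdecK c a : (0 < a c)%N -> minc c (mdec c a) = a.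
Proof.
move=> ac; apply/funext => c'; rewrite /minc /mdec.
by case: eqP => [<-|_]; rewrite ?subn1 ?addn1 ?prednK // subn0 addn0.
Qed.

Lemma mincK c a : mdec c (minc c a) = a.
Proof. by apply/funext => c'; rewrite /minc /mdec addnK. Qed.

Lemma msize_minc c a : msize (minc c a) = (msize a).+1.
Proof.
rewrite /msize /minc big_split /= -addn1; congr addn.
by rewrite (bigD1 c) //= eqxx big1 // => c' /negbTE; rewrite eq_sym => ->.
Qed.

Lemma msize_mdec c a : (0 < a c)%N -> (msize (mdec c a)).+1 = msize a.
Proof. by move=> ac; rewrite -(msize_minc c) mdecK. Qed.

Lemma msize_madd a b : msize (madd a b) = (msize a + msize b)%N.
Proof. by rewrite /msize /madd big_split. Qed.

Lemma msize_ge a c : (a c <= msize a)%N.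
Proof. by rewrite /msize (bigD1 c) //= leq_addr. Qed.

Lemma msize_eq0 a : msize a = 0%N -> a = mzero.
Proof.
move=> a0; apply/funext => c; apply/eqP; rewrite -leqn0 -[X in (_ <= X)%N]a0.
exact: msize_ge.
Qed.

Lemma msize_mzero : msize mzero = 0%N.
Proof. by rewrite /msize big1. Qed.

Lemma mfac_mdec c a : (0 < a c)%N -> mfac a = (a c * mfac (mdec c a))%N.
Proof.
move=> ac; rewrite /mfac (bigD1 c) //= [in RHS](bigD1 c) //= mulnA.
congr (_ * _)%N.
  by rewrite /mdec eqxx subn1; case: (a c) ac => // k _; rewrite factS.
by apply: eq_bigr => c' /negbTE; rewrite eq_sym /mdec => ->; rewrite subn0.
Qed.

Lemma mbin_neq0 q b : mbin q b != 0%N -> forall c, (b c <= q c)%N.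
Proof.
move=> H c; rewrite leqNgt; apply: contra H => H.
by rewrite /mbin (bigD1 c) //= bin_small.
Qed.

(** Pascal's rule: only the factor of the direction [c] changes. *)
Lemma mbin_minc c q b :
  mbin (minc c q) b = (mbin q b + (0 < b c) * mbin q (mdec c b))%N.
Proof.
rewrite /mbin !(bigD1 c (P := xpredT)) //=.
have E (f : mindex) (x : mindex) : (forall c', c' != c -> f c' = x c') ->
   (\prod_(c' | c' != c) 'C(q c', f c') = \prod_(c' | c' != c) 'C(q c', x c'))%N.
  by move=> fx; apply: eq_bigr => c' /fx ->.
rewrite (E (mdec c b) b) => [|c' /negbTE]; last by rewrite eq_sym /mdec => ->; rewrite subn0.
have -> : (\prod_(i | i != c) 'C(minc c q i, b i) = \prod_(i | i != c) 'C(q i, b i))%N.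
  by apply: eq_bigr => c' /negbTE; rewrite eq_sym /minc => ->; rewrite addn0.
rewrite mulnA -mulnDl; congr (_ * _)%N.
rewrite /minc /mdec eqxx addn1 subn1; case: (b c) => [|k] /=.
  by rewrite !bin0.
by rewrite binS mul1n.
Qed.

End MultiIndices.

Section MultiIndexSums.
Context {d : nat} (n : nat).
Local Notation C := (option 'I_d).
Local Notation mindex := (C -> nat).
Implicit Types (a b q : mindex) (c : C).

(** The nested form is the one of the estimate to be proved; [msumE] flattens it
    for all other purposes. The bound [n] only makes the range finite: the
    summands vanish beyond total degree [n]. *)
Definition msum (S : nmodType) (F : mindex -> S) : S :=
  \sum_(l < n.+1) \sum_(j : {ffun 'I_d -> 'I_n.+1})
    F (mindex_of l (fun i => j i)).

Lemma msumE (S : nmodType) (F : mindex -> S) :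
  msum F = \sum_(b : {ffun C -> 'I_n.+1}) F (fun c => b c).
Proof.
rewrite /msum pair_big /=.
pose h (b : {ffun C -> 'I_n.+1}) := (b None, [ffun i => b (Some i)]).
pose g (p : 'I_n.+1 * {ffun 'I_d -> 'I_n.+1}) :=
  [ffun c : C => (if c is Some i then p.2 i else p.1) : 'I_n.+1].
rewrite (reindex h) /=.
  by apply: eq_bigr => b _; congr F; apply/funext => -[i|] //=; rewrite ffunE.
exists g => [b _|[l j] _].
  by apply/ffunP => -[i|]; rewrite !ffunE //= ffunE.
by congr pair; rewrite ?ffunE //; apply/ffunP => i; rewrite !ffunE.
Qed.

Lemma eq_msum (S : nmodType) (F G : mindex -> S) :
  (forall a, (forall c, (a c <= n)%N) -> F a = G a) -> msum F = msum G.
Proof.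
by move=> H; rewrite !msumE; apply: eq_bigr => b _; apply: H => c; rewrite -ltnS.
Qed.

(** The translation by [c] maps the indices with [a c < n] onto those with
    [0 < a c]; the hypothesis discards the others. *)
Lemma msum_shift (S : nmodType) (F : mindex -> S) c :
  (forall a, (forall c', (a c' <= n)%N) -> a c = n -> F a = 0) ->
  msum F = msum (fun a => if (0 < a c)%N then F (mdec c a) else 0).
Proof.
move=> F0; rewrite !msumE -[RHS]big_mkcond /=.
pose h (b : {ffun C -> 'I_n.+1}) : {ffun C -> 'I_n.+1} :=
  [ffun c' => inord (mdec c (fun c => b c) c')].
pose g (b : {ffun C -> 'I_n.+1}) : {ffun C -> 'I_n.+1} :=
  [ffun c' => inord (minc c (fun c => b c) c')].
have bn (b : {ffun C -> 'I_n.+1}) c' : (b c' <= n)%N by rewrite -ltnS.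
have hE (b : {ffun C -> 'I_n.+1}) c' : h b c' = mdec c (fun c => b c) c' :> nat.
  by rewrite ffunE inordK // ltnS /mdec (leq_trans (leq_subr _ _)).
have gE (b : {ffun C -> 'I_n.+1}) c' : (b c < n)%N ->
    g b c' = minc c (fun c => b c) c' :> nat.
  move=> bc; rewrite ffunE inordK // ltnS /minc.
  by case: eqP => [<-|_]; rewrite ?addn1 ?addn0.
rewrite (bigID (fun b : {ffun C -> 'I_n.+1} => b c < n)%N) /=.
rewrite [X in _ + X]big1 ?addr0; last first.
  move=> b; rewrite -leqNgt => nb; apply: F0 => [c'|]; first exact: bn.
  by apply/eqP; rewrite eqn_leq bn.
rewrite (reindex_onto h g) => [|b bc]; last first.
  apply/ffunP => c'; apply: val_inj; rewrite /= hE.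
  rewrite (_ : (fun c => g b c : nat) = minc c (fun c => b c)) ?mincK //.
  by apply/funext => c''; rewrite gE.
apply: eq_big => [b|b _]; last first.
  by congr F; apply/funext => c'; rewrite hE.
rewrite hE /mdec eqxx subn1; case: (posnP (b c)) => [b0|b0].
  rewrite b0 /=; apply/negbTE/negP => /andP [n0 /eqP /ffunP /(_ c)].
  move=> /(congr1 val) /=; rewrite gE ?hE /minc /mdec ?hE /mdec b0 eqxx ?subn1 //=.
have lt : ((b c).-1 < n)%N by case: (b c : nat) b0 (bn b c) => // k _.
rewrite lt /=; apply/eqP/ffunP => c'; apply: val_inj; rewrite /= gE; last first.
  by rewrite hE /mdec eqxx subn1.
rewrite (_ : (fun c => h b c : nat) = mdec c (fun c => b c)) ?mdecK //.
by apply/funext => c''; rewrite hE.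
Qed.

(** How differentiation in one variable acts on a sum of monomials
    [x ^ a / a!]: the degree in direction [c] drops by one. *)
Lemma msum_shift_fac (R : realFieldType) (P : pred nat) (X : mindex -> R) c :
  (forall k, P k -> (k <= n)%N) ->
  msum (fun a => if P (msize a) then (a c)%:R / (mfac a)%:R * X (mdec c a) else 0)
  = msum (fun a => if P (msize a).+1 then (mfac a)%:R^-1 * X a else 0).
Proof.
move=> Pn; rewrite [RHS](@msum_shift _ _ c); last first.
  move=> a _ ac; case: ifP => // /Pn; have := msize_ge a c; rewrite ac.
  by move=> H1 H2; have := leq_trans H2 H1; rewrite ltnn.
apply: eq_msum => a _; case: (posnP (a c)) => [->|ac].
  by rewrite !mul0r if_same.
rewrite msize_mdec //; case: ifP => // _; congr (_ * _).
rewrite (mfac_mdec ac) natrM invfM mulrA mulfV ?mul1r //.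
by rewrite pnatr_eq0 -lt0n.
Qed.

(** Euler's identity: a sum homogeneous of degree [k], multiplied by [k], is the
    sum over the directions of its derivatives. *)
Lemma msum_euler (R : realFieldType) (P : pred nat) (X : mindex -> R) :
  (forall k, P k -> (k <= n)%N) ->
  msum (fun a => if P (msize a) then (msize a)%:R / (mfac a)%:R * X a else 0)
  = \sum_c msum (fun a => if P (msize a).+1 then
                            (mfac a)%:R^-1 * X (minc c a) else 0).
Proof.
move=> Pn; rewrite (eq_bigr _ (fun c _ => esym (msum_shift_fac _ c Pn))).
rewrite msumE; under [RHS]eq_bigr do rewrite msumE.
rewrite exchange_big /=; apply: eq_bigr => b _; case: ifP => _; last by rewrite big1.
under eq_bigr => c _.
  rewrite (_ : _ * X _ = (b c)%:R * ((mfac (fun c => b c))%:R^-1 * X (fun c => b c))).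
  over.
  rewrite /= mulrA; case: (posnP (b c)) => [->|bc]; first by rewrite !mul0r.
  by rewrite mdecK.
by rewrite -mulr_suml -natr_sum mulrA.
Qed.

End MultiIndexSums.

(** * Averages over cells *)

Section PointwiseRules.
Context {R : realType} {V : normedModType R}.
Implicit Types (f g : V -> R) (z v : V).

Lemma is_derive_add f g z v (df dg : R) :
  is_derive z v f df -> is_derive z v g dg ->
  is_derive z v (fun y => f y + g y) (df + dg).
Proof. by move=> Hf Hg; exact: is_deriveD. Qed.

Lemma is_derive_sub f g z v (df dg : R) :
  is_derive z v f df -> is_derive z v g dg ->
  is_derive z v (fun y => f y - g y) (df - dg).
Proof. by move=> Hf Hg; exact: is_deriveB. Qed.

Lemma is_derive_mul f g z v (df dg : R) :
  is_derive z v f df -> is_derive z v g dg ->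
  is_derive z v (fun y => f y * g y) (f z * dg + df * g z).
Proof. by move=> Hf Hg; rewrite [df * _]mulrC; exact: is_deriveM. Qed.

Lemma is_derive_const (a : R) z v : is_derive z v (fun=> a) 0.
Proof. exact: is_derive_cst. Qed.

Lemma is_derive_scale (a : R) f z v (df : R) :
  is_derive z v f df -> is_derive z v (fun y => a * f y) (a * df).
Proof.
move=> Hf; have := is_derive_mul (is_derive_const a z v) Hf.
by rewrite mul0r addr0.
Qed.

Lemma is_derive_bigsum (I : Type) (r : seq I) (P : pred I) (F : I -> V -> R)
    (dF : I -> R) z v :
  (forall i, P i -> is_derive z v (F i) (dF i)) ->
  is_derive z v (fun y => \sum_(i <- r | P i) F i y) (\sum_(i <- r | P i) dF i).
Proof.
move=> HF; elim: r => [|i r IH].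
  rewrite big_nil; under [X in is_derive _ _ X _]eq_fun do rewrite big_nil.
  exact: is_derive_const.
rewrite big_cons; under [X in is_derive _ _ X _]eq_fun do rewrite big_cons.
by case: ifP => // /HF Hi; exact: is_derive_add.
Qed.

End PointwiseRules.

Section ContinuityRules.
Context {R : realType} {T : topologicalType}.

Lemma continuous_bigprod (I : Type) (r : seq I) (P : pred I) (F : I -> T -> R) :
  (forall i, P i -> continuous (F i)) ->
  continuous (fun x => \prod_(i <- r | P i) F i x).
Proof.
move=> HF; elim: r => [|i r IH] x.
  under eq_fun do rewrite big_nil.
  exact: cvg_cst.
under eq_fun do rewrite big_cons.
case: ifP => [Pi|_]; last exact: IH.
exact: (cvgM (HF i Pi x) (IH x)).
Qed.

Lemma continuous_exp (f : T -> R) k : continuous f -> continuous (fun x => f x ^+ k).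
Proof.
move=> Hf; elim: k => [|k IH] x.
  under eq_fun do rewrite expr0.
  exact: cvg_cst.
under eq_fun do rewrite exprS.
exact: (cvgM (Hf x) (IH x)).
Qed.

Lemma continuous_bigsum (I : Type) (r : seq I) (P : pred I) (F : I -> T -> R) :
  (forall i, P i -> continuous (F i)) ->
  continuous (fun x => \sum_(i <- r | P i) F i x).
Proof.
move=> HF; elim: r => [|i r IH] x.
  under eq_fun do rewrite big_nil.
  exact: cvg_cst.
under eq_fun do rewrite big_cons.
case: ifP => [Pi|_]; last exact: IH.
exact: (cvgD (HF i Pi x) (IH x)).
Qed.

Lemma continuous_lincomb (a : R) (f g : T -> R) : continuous f -> continuous g ->
  continuous (fun x => a * f x + g x).
Proof. 
move=> Hf Hg x; apply: (cvgD _ (Hg x)).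
exact: (cvgM (cvg_cst a) (Hf x)).
Qed.

Lemma continuous_mul (f g : T -> R) : continuous f -> continuous g ->
  continuous (fun x => f x * g x).
Proof. by move=> Hf Hg x; apply: (cvgM (Hf x) (Hg x)). Qed.

End ContinuityRules.

Section CellIntegral.
Context {R : realType} (w : R) (hw : 0 < w).
Implicit Types (k : int) (h g : R -> R).

Lemma cellP k t : cell w k t <-> k%:~R / w <= t <= (k + 1)%:~R / w.
Proof. by rewrite /cell /= in_itv. Qed.

Lemma measurable_cell k : measurable (cell w k : set (measurableTypeR R)).
Proof. exact: measurable_itv. Qed.

Lemma cell_measure k : fine (lebesgue_measure (cell w k)) = w^-1.
Proof.
rewrite /cell lebesgue_measure_itv /= lte_fin ltr_pM2r ?invr_gt0 //.
by rewrite ltr_int ltzD1 lexx /= -mulrBl intrD addrAC subrr add0r mul1r.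
Qed.

Lemma integrable_cell k h : continuous h ->
  (@lebesgue_measure R).-integrable (cell w k) (EFin \o h).
Proof.
move=> ch; apply: continuous_compact_integrable; first exact: segment_compact.
exact: continuous_subspaceT.
Qed.

Lemma cell_integral_lin k (a : R) h g : continuous h -> continuous g ->
  \int[lebesgue_measure]_(t in cell w k) (a * h t + g t) =
  a * (\int[lebesgue_measure]_(t in cell w k) h t)
  + \int[lebesgue_measure]_(t in cell w k) g t.
Proof.
move=> ch cg; have mk := measurable_cell k.
have cah : continuous (fun t => a * h t) 
  by move=> x; exact: (cvgM (cvg_cst a) (ch x)).
rewrite RintegralD // ?RintegralZl //; exact: integrable_cell.
Qed.

Lemma cell_integral_cst k (a : R) :
  \int[lebesgue_measure]_(t in cell w k) a = a / w.
Proof. by rewrite Rintegral_cst ?cell_measure //; exact: measurable_cell. Qed.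

Lemma cell_integral_bound k h (B : R) : continuous h ->
  (forall t, cell w k t -> `|h t| <= B) ->
  `|\int[lebesgue_measure]_(t in cell w k) h t| <= B / w.
Proof.
move=> ch hB; have mk := measurable_cell k.
have L := le_normr_Rintegral mk (integrable_cell k ch); apply: (le_trans L).
rewrite -(cell_integral_cst k); apply: le_Rintegral => //.
- by apply: integrable_cell => x; apply: cvg_norm; exact: ch.
- by apply: integrable_cell => x; exact: cvg_cst.
Qed.

End CellIntegral.

Section CellAverage.
Context {R : realType} {d : nat} (w : R) (hw : 0 < w).
Local Notation C := (option 'I_d).
Local Notation V := (R * 'rV[R]_d)%type.
Implicit Types (z : V) (c : C) (t : R) (g h : V -> R) (kappa : C -> int).

Definition upd z c t : V := z + (t - coord z c) *: axis R c.

Lemma coord_upd z c t c' : coord (upd z c t) c' = if c == c' then t else coord z c'.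
Proof.
rewrite coord_shift; case: eqP => [<-|_]; last by rewrite mulr0 addr0.
by rewrite mulr1 addrC subrK.
Qed.

Lemma continuous_upd g z c : continuous g -> continuous (fun t => g (upd z c t)).
Proof.
move=> cg t0; apply/cvgrPdist_lt => e e0.
have : \forall y \near upd z c t0, `|g (upd z c t0) - g y| < e.
  by move: (@cg (upd z c t0)) => /cvgrPdist_lt; apply.
rewrite near_coordP => -[r r0 Hr]; apply/nbhs_ballP; exists r => // t /=.
rewrite /ball /= distrC => tr; apply: Hr => c'; rewrite !coord_upd.
by case: eqP => // _; rewrite subrr normr0.
Qed.

Definition cellint kappa c g : V -> R :=
  fun z => \int[lebesgue_measure]_(t in cell w (kappa c)) g (upd z c t).

(** Integration over a compact interval preserves continuity in the other
    variables: a tube of uniform closeness around the segment exists by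
    compactness. *)
Lemma continuous_cellint kappa c g : continuous g -> continuous (cellint kappa c g).
Proof.
move=> cg z; apply/cvgrPdist_le => e e0.
have ew : 0 < e * w by rewrite mulr_gt0.
have e2 : 0 < e * w / 2 by rewrite divr_gt0.
have : \forall y \near z, cell w (kappa c) `<=`
    (fun t => `|g (upd z c t) - g (upd y c t)| <= e * w).
  have NC := (compact_near_coveringP _).1
    (@segment_compact R ((kappa c)%:~R / w) ((kappa c + 1)%:~R / w)).
  apply: (NC _ (nbhs z) (fun y t => `|g (upd z c t) - g (upd y c t)| <= e * w)).
  move=> t0 _.
  have : \forall y \near upd z c t0, `|g (upd z c t0) - g y| < e * w / 2.
    by move: (@cg (upd z c t0)) => /cvgrPdist_lt; apply.
  rewrite near_coordP => -[r r0 Hr].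
  have Nz : \forall y \near z, forall c, `|coord y c - coord z c| < r.
    by rewrite near_coordP; exists r.
  have Nt : \forall t \near t0, `|t - t0| < r.
    by apply/nbhs_ballP; exists r => // t; rewrite /ball /= distrC.
  near=> t y => /=.
  have Ht : `|t - t0| < r by near: t.
  have Hy c' : `|coord y c' - coord z c'| < r by move: c'; near: y.
  have H1 : `|g (upd z c t0) - g (upd z c t)| < e * w / 2.
    apply: Hr => c'; rewrite !coord_upd.
    by case: eqP => // _; rewrite subrr normr0.
  have H2 : `|g (upd z c t0) - g (upd y c t)| < e * w / 2.
    by apply: Hr => c'; rewrite !coord_upd; case: eqP.
  have -> : g (upd z c t) - g (upd y c t) =
    (g (upd z c t0) - g (upd y c t)) - (g (upd z c t0) - g (upd z c t)) by ring.
  apply: le_trans (ler_normB _ _) _; rewrite [e * w]splitr.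
  by apply: lerD; exact: ltW.
apply: filterS => y Hy.
have Cz := @continuous_upd g z c cg; have Cy := @continuous_upd g y c cg.
rewrite /cellint.
have -> : \int[lebesgue_measure]_(t in cell w (kappa c)) g (upd z c t) -
   \int[lebesgue_measure]_(t in cell w (kappa c)) g (upd y c t) =
   \int[lebesgue_measure]_(t in cell w (kappa c)) (-1 * g (upd y c t) + g (upd z c t)).
  by rewrite cell_integral_lin // mulN1r addrC.
have -> : e = e * w / w by rewrite mulfK // gt_eqF.
apply: cell_integral_bound => //.
  exact: (@continuous_lincomb R R (-1) _ _ Cy Cz).
by move=> t /Hy; rewrite mulN1r addrC.
Unshelve. all: by end_near. Qed.

Definition iterint kappa (s : seq C) g : V -> R :=
  foldr (fun c h => cellint kappa c h) g s.

Lemma continuous_iterint kappa s g : continuous g -> continuous (iterint kappa s g).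
Proof. by move=> cg; elim: s => [|c s IH] //=; exact: continuous_cellint. Qed.

Lemma iterint_lin kappa s (a : R) g h : continuous g -> continuous h ->
  iterint kappa s (fun z => a * g z + h z) =
  fun z => a * iterint kappa s g z + iterint kappa s h z.
Proof.
move=> cg ch; elim: s => [|c s IH] //=; rewrite IH; apply/funext => z.
rewrite /cellint cell_integral_lin //; apply: continuous_upd; exact: continuous_iterint.
Qed.

Lemma iterint_cst kappa s (a : R) :
  iterint kappa s (fun=> a) = fun=> a / w ^+ size s.
Proof.
elim: s => [|c s IH] /=; first by rewrite divr1.
rewrite IH; apply/funext => z; rewrite /cellint cell_integral_cst //.
by rewrite exprS invfM mulrA mulrAC.
Qed.

(** The directions of [s] are integrated, so [g] is only seen at points that lie
    in the cell in these directions and agree with [z] in the others. *)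
Lemma iterint_bound kappa s g (B : R) z : continuous g ->
  (forall y, (forall c, c \in s -> cell w (kappa c) (coord y c)) ->
    (forall c, c \notin s -> coord y c = coord z c) -> `|g y| <= B) ->
  `|iterint kappa s g z| <= B / w ^+ size s.
Proof.
move=> cg; elim: s z => [|c s IH] z H /=.
  by rewrite divr1; apply: H.
have -> : B / w ^+ (size s).+1 = B / w ^+ size s / w by rewrite exprSr invfM mulrA.
apply: cell_integral_bound => //.
  by apply: continuous_upd; exact: continuous_iterint.
move=> t ct; apply: IH => y Hs Hn; apply: H => [c'|c'].
  rewrite inE => /orP [/eqP ->|]; last exact: Hs.
  have [cs|cs] := boolP (c \in s); first exact: Hs.
  by rewrite Hn // coord_upd eqxx.
rewrite inE negb_or => /andP [c'c c's].
by rewrite Hn // coord_upd eq_sym (negbTE c'c).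
Qed.

(** The mean of [g] over the product of the cells. It enters the proofs only as
    a positive linear functional on continuous functions with value 1 at 1. *)
Definition cell_average kappa g : R :=
  w ^+ d.+1 * iterint kappa (None :: map Some (enum 'I_d)) g 0.

Lemma size_coords : size (None :: map (@Some 'I_d) (enum 'I_d)) = d.+1.
Proof. by rewrite /= size_map size_enum_ord. Qed.

Lemma cell_average_lin kappa (a : R) g h : continuous g -> continuous h ->
  cell_average kappa (fun z => a * g z + h z) =
  a * cell_average kappa g + cell_average kappa h.
Proof.
by move=> cg ch; rewrite /cell_average iterint_lin // mulrDr mulrCA.
Qed.

Lemma cell_average_cst kappa (a : R) : cell_average kappa (fun=> a) = a.
Proof.
rewrite /cell_average iterint_cst size_coords mulrC mulfVK //.
by rewrite expf_neq0 // gt_eqF.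
Qed.

Lemma cell_averageZ kappa (a : R) g : continuous g ->
  cell_average kappa (fun z => a * g z) = a * cell_average kappa g.
Proof.
move=> cg; have := @cell_average_lin kappa a g (fun=> 0) cg (fun=> @cvg_cst _ _ _ _ _).
rewrite cell_average_cst addr0 => <-; congr cell_average.
by apply/funext => z; rewrite addr0.
Qed.

Lemma cell_average_sum kappa (I : Type) (r : seq I) (P : pred I) (F : I -> V -> R) :
  (forall i, P i -> continuous (F i)) ->
  cell_average kappa (fun z => \sum_(i <- r | P i) F i z) =
  \sum_(i <- r | P i) cell_average kappa (F i).
Proof.
move=> cF; elim: r => [|i r IH].
  rewrite big_nil; under eq_fun do rewrite big_nil.
  exact: cell_average_cst.
rewrite big_cons; under eq_fun do rewrite big_cons.
case: ifP => // Pi; rewrite -IH -[cell_average _ (F i)]mul1r.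
rewrite -cell_average_lin //; last exact: continuous_bigsum.
  by congr cell_average; apply/funext => z; rewrite mul1r.
exact: cF.
Qed.

Lemma cell_average_bound kappa g (B : R) : continuous g ->
  (forall y, (forall c, cell w (kappa c) (coord y c)) -> `|g y| <= B) ->
  `|cell_average kappa g| <= B.
Proof.
move=> cg H; rewrite /cell_average normrM ger0_norm; last by rewrite exprn_ge0 // ltW.
rewrite mulrC -ler_pdivlMr ?exprn_gt0 // -size_coords.
apply: iterint_bound => // y Hy _; apply: H => c; apply: Hy.
by case: c => [i|] //; rewrite inE /= map_f // mem_enum.
Qed.

(** Moving one factor [x - coord y c] out of the average makes this an induction
    on the exponent, for all [h] at once; no differentiation under the integral
    sign is involved. *)
Lemma is_derive_cell_average kappa h c l (x : R) : continuous h ->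
  is_derive x (1 : R) (fun x => cell_average kappa (fun y => h y * (x - coord y c) ^+ l))
   (l%:R * cell_average kappa (fun y => h y * (x - coord y c) ^+ l.-1)).
Proof.
have cc x0 : continuous (fun y : V => x0 - coord y c).
  by move=> y; apply: cvgB; [exact: cvg_cst|exact: continuous_coord].
elim: l h => [|l IH] h ch.
  rewrite mul0r; under eq_fun do under eq_fun do rewrite expr0.
  exact: is_derive_const.
pose h' y := h y * coord y c.
have ch' : continuous h' by apply: continuous_mul => //; exact: continuous_coord.
have cp (f : V -> R) k (x0 : R) : continuous f -> continuous (fun y : V => f y * (x0 - coord y c) ^+ k).
  by move=> cf; apply: continuous_mul => //; apply: continuous_exp; exact: cc.
have E k x0 : cell_average kappa (fun y => h y * (x0 - coord y c) ^+ k.+1) =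
    x0 * cell_average kappa (fun y => h y * (x0 - coord y c) ^+ k)
    - cell_average kappa (fun y => h' y * (x0 - coord y c) ^+ k).
  rewrite -cell_averageZ; last exact: cp.
  rewrite addrC -[- cell_average _ _]mulN1r -cell_average_lin; [|exact: cp|].
    by congr cell_average; apply/funext => y; rewrite /h' exprS; ring.
  by apply: continuous_mul; [move=> y; exact: cvg_cst|exact: cp].
under [X in is_derive _ _ X _]eq_fun do rewrite E.
apply: is_derive_eq.
  apply: is_derive_sub; last exact: IH.
  apply: is_derive_mul; last exact: IH.
rewrite /= mul1r; case: l IH => [|l] IH; first by rewrite !mul0r mulr0 add0r subr0 mul1r.
by rewrite /= E -[l.+2%:R]natr1; ring.
Qed.

End CellAverage.

Section BoxIntegral.
Context {R : realType} {d : nat}.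
Local Notation V := (R * 'rV[R]_d)%type.

Definition idx (km : int * {ffun 'I_d -> int}) (c : option 'I_d) : int :=
  if c is Some i then km.2 i else km.1.

(** Integrating the coordinates one after the other from the base point 0 is
    what [iterint] does, the first variable being outermost. *)
Lemma box_integralE (w : R) (km : int * {ffun 'I_d -> int}) (g : V -> R) :
  w ^+ d.+1 * (\int[lebesgue_measure]_(u in cell w km.1)
     box_integral w km.2 (fun v => g (u, v))) = cell_average w (idx km) g.
Proof.
rewrite /cell_average /=; congr (_ * _); apply: eq_Rintegral => u _.
have -> : upd 0 None u = (u, 0) :> V.
  by apply: eq_coord => -[i|]; rewrite coord_upd //= mxE.
rewrite /box_integral; elim: (enum 'I_d) (0 : 'rV[R]_d) => [|i s IH] v //=.
apply: eq_Rintegral => t _; rewrite IH; congr iterint.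
apply: eq_coord => -[j|]; rewrite coord_upd //= mxE.
by have -> : (Some i == Some j) = (j == i) by rewrite eq_sym.
Qed.

End BoxIntegral.

(** * Taylor polynomials, their remainders and their averages *)

Lemma is_derive_monomial (R : realType) (a b : R) k (x : R) :
  is_derive x (1 : R) (fun y => a * (y ^+ k * b)) (a * (k%:R * x ^+ k.-1 * b)).
Proof.
have := is_derive_scale a (is_derive_mul (is_deriveX k (is_derive_id x (1 : R)))
  (is_derive_const b x 1)).
by rewrite exprfctE mulr0 add0r /GRing.scale /= mulr1.
Qed.

Section MultiIndexSumRules.
Context {R : realType} {d n : nat}.
Local Notation C := (option 'I_d).
Local Notation mindex := (C -> nat).
Local Notation msum := (@msum d n).

Lemma msum_mulr (a : R) (F : mindex -> R) : a * msum F = msum (fun b => a * F b).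
Proof. by rewrite !msumE mulr_sumr. Qed.

Lemma msumD (F G : mindex -> R) : msum (fun a => F a + G a) = msum F + msum G.
Proof. by rewrite !msumE big_split. Qed.

Lemma msumN (F : mindex -> R) : msum (fun a => - F a) = - msum F.
Proof. by rewrite !msumE sumrN. Qed.

Lemma ler_msum (F G : mindex -> R) : (forall a, F a <= G a) -> msum F <= msum G.
Proof. by move=> H; rewrite !msumE; apply: ler_sum. Qed.

Lemma ler_norm_msum (F : mindex -> R) : `|msum F| <= msum (fun a => `|F a|).
Proof. by rewrite !msumE; exact: ler_norm_sum. Qed.

Lemma exchange_msum (I : Type) (r : seq I) (P : pred I) (F : I -> mindex -> R) :
  \sum_(i <- r | P i) msum (F i) = msum (fun a => \sum_(i <- r | P i) F i a).
Proof. by under eq_bigr do rewrite msumE; rewrite msumE exchange_big. Qed.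

Lemma msum_pick0 (F : mindex -> R) :
  msum (fun a => if msize a == 0%N then F a else 0) = F mzero.
Proof.
rewrite msumE (bigD1 [ffun=> ord0]) //= big1 ?addr0 => [|b b0].
  have -> : (fun c : C => [ffun=> ord0 : 'I_n.+1] c : nat) = mzero.
    by apply/funext => c; rewrite ffunE.
  by rewrite msize_mzero.
case: eqP => // /msize_eq0 E; case/eqP: b0; apply/ffunP => c.
by rewrite ffunE; apply: val_inj; rewrite /= (congr1 (@^~ c) E).
Qed.

Lemma is_derive_msum (V : normedModType R) (F : mindex -> V -> R) (dF : mindex -> R)
    (z v : V) : (forall a, is_derive z v (F a) (dF a)) ->
  is_derive z v (fun y => msum (fun a => F a y)) (msum dF).
Proof.
move=> H; rewrite msumE; under [X in is_derive _ _ X _]eq_fun do rewrite msumE.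
exact: is_derive_bigsum.
Qed.

Lemma continuous_msum (T : topologicalType) (F : mindex -> T -> R) :
  (forall a, continuous (F a)) -> continuous (fun y => msum (fun a => F a y)).
Proof.
by move=> H; under [X in continuous X]eq_fun do rewrite msumE; exact: continuous_bigsum.
Qed.

End MultiIndexSumRules.

Section Taylor.
Context {R : realType} {d n : nat}.
Local Notation C := (option 'I_d).
Local Notation V := (R * 'rV[R]_d)%type.
Local Notation mindex := (C -> nat).
Local Notation msum := (@msum d n).
Implicit Types (a b g : mindex) (c : C) (z v xi : V).

Definition mpow v a : R := \prod_c coord v c ^+ a c.

Lemma mpowZ (t : R) v a : mpow (t *: v) a = t ^+ msize a * mpow v a.
Proof.
rewrite /mpow /msize -prodrXr -big_split /=.
by apply: eq_bigr => c _; rewrite coordZ exprMn.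
Qed.

Lemma mpow_minc v a c : mpow v (minc c a) = coord v c * mpow v a.
Proof.
rewrite /mpow (bigD1 c) //= [in RHS](bigD1 c) //= mulrA; congr (_ * _).
  by rewrite /minc eqxx addn1 exprS.
by apply: eq_bigr => c' /negbTE; rewrite eq_sym /minc => ->; rewrite addn0.
Qed.

Lemma mpow_mzero v : mpow v mzero = 1.
Proof. by rewrite /mpow big1. Qed.

(** A family [D g] standing for the partial derivatives of one function up to
    the order [n]; only those of order exactly [n] are required to be bounded. *)
Record jet (D : mindex -> V -> R) : Prop := Jet {
  jet_cont : forall g, (msize g <= n)%N -> continuous (D g);
  jet_derive : forall g c z, (msize g < n)%N ->
    is_derive z (axis R c) (D g) (D (minc c g) z);
  jet_bounded : forall g, msize g = n -> exists B, forall z, `|D g z| <= B }.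

Variable D : mindex -> V -> R.
Hypothesis HD : jet D.

(** The Taylor polynomial of [D g] at [xi], evaluated at [z]; the total order is
    [n], so that the polynomial of a derivative has a lower degree. *)
Definition taylor g xi z : R := msum (fun a =>
  if (msize a + msize g <= n)%N then
    (mfac a)%:R^-1 * (D (madd a g) xi * mpow (z - xi) a) else 0).

(** Along a line the remainder of order [n - msize g] is, up to the factors
    [coord v c], the primitive of the remainders of the first derivatives; the
    estimate is integrated from there. *)
Lemma taylor_remainder (xi v : V) (Omega : mindex -> R) g (t : R) :
  (msize g <= n)%N ->
  (forall b, msize b = n -> forall s : R, 0 <= s <= 1 ->
     `|D b (xi + s *: v) - D b xi| <= Omega b) ->
  0 <= t <= 1 ->
  `|D g (xi + t *: v) - taylor g xi (xi + t *: v)| <=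
    t ^+ (n - msize g) * msum (fun a => if (msize a + msize g == n)%N then
      (mfac a)%:R^-1 * (`|mpow v a| * Omega (madd a g)) else 0).
Proof.
move=> gn HO; move: {2}(n - msize g)%N (erefl (n - msize g)%N) => N.
have m0 b : madd mzero b = b by apply/funext.
elim: N g gn t => [|N IH] g gn t gN t01.
  have {}gn : msize g = n by apply/eqP; rewrite eqn_leq gn -subn_eq0 gN.
  rewrite gN expr0 mul1r.
  rewrite (@eq_msum _ _ _ _ (fun a => if msize a == 0%N then
     (mfac a)%:R^-1 * (`|mpow v a| * Omega (madd a g)) else 0)); last first.
    by move=> a _; rewrite gn -[X in _ == X]add0n eqn_add2r.
  rewrite /taylor (@eq_msum _ _ _ _ (fun a => if msize a == 0%N then
     (mfac a)%:R^-1 * (D (madd a g) xi * mpow (xi + t *: v - xi) a) else 0)); last first.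
    by move=> a _; rewrite gn -[X in (_ <= X)%N]add0n leq_add2r leqn0.
  rewrite !msum_pick0 !mpow_mzero normr1 !mul1r mulr1.
  have -> : mfac (@mzero d) = 1%N by rewrite /mfac big1.
  by rewrite invr1 !mul1r m0; exact: HO.
have gn' : (msize g < n)%N by rewrite -subn_gt0 gN.
pose P k := (k + msize g <= n)%N.
have Pn k : P k -> (k <= n)%N by apply: leq_trans; rewrite leq_addr.
have TE (x : R) : taylor g xi (xi + x *: v) = msum (fun a => if P (msize a) then
    (mfac a)%:R^-1 * (x ^+ msize a * (D (madd a g) xi * mpow v a)) else 0).
  apply: eq_msum => a _; rewrite /P; case: ifP => // _; congr (_ * _).
  by rewrite (addrC xi) addrK mpowZ mulrCA.
pose r c (x : R) := D (minc c g) (xi + x *: v) - taylor (minc c g) xi (xi + x *: v).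
set S := msum _.
have HR (x : R) : is_derive x (1 : R)
    (fun x => D g (xi + x *: v) - taylor g xi (xi + x *: v))
    (\sum_c coord v c * r c x).
  under [X in is_derive _ _ X _]eq_fun do rewrite TE.
  apply: is_derive_eq.
    apply: is_derive_sub.
      apply: (@is_derive_line R d _ (fun c => D (minc c g))) => [c z|c].
        exact: jet_derive.
      by apply: jet_cont => //; rewrite msize_minc.
    apply: (@is_derive_msum _ _ _ _ _ (fun a => if P (msize a) then
      (msize a)%:R / (mfac a)%:R * (x ^+ (msize a).-1 * (D (madd a g) xi * mpow v a))
      else 0)) => a.
    case: ifP => _; last exact: is_derive_const.
    by apply: is_derive_eq; [exact: is_derive_monomial|ring].
  rewrite msum_euler // -sumrB; apply: eq_bigr => c _.
  rewrite /r mulrBr; congr (_ - _); rewrite /taylor msum_mulr; apply: eq_msum => a _.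
  rewrite /P !msize_minc addnS addSn; case: ifP => _; last by rewrite mulr0.
  rewrite (addrC xi) addrK mpowZ mpow_minc /=.
  have -> : madd (minc c a) g = madd a (minc c g).
    by apply/funext => c'; rewrite /madd /minc addnAC addnA.
  by ring.
have HG (x : R) : is_derive x (1 : R) (fun x => x ^+ N.+1 * S)
    (N.+1%:R * x ^+ N * S).
  have := is_derive_monomial 1 S N.+1 x.
  by under [X in is_derive _ _ X _ -> _]eq_fun do rewrite mul1r; rewrite mul1r.
rewrite gN.
apply: (le_norm_of_derive HR HG) => //; last 2 first.
- rewrite TE (@eq_msum _ _ _ _ (fun a => if msize a == 0%N then
     (mfac a)%:R^-1 * (D (madd a g) xi * mpow v a) else 0)).
    rewrite msum_pick0 mpow_mzero m0 mulr1 scale0r addr0.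
    have -> : mfac (@mzero d) = 1%N by rewrite /mfac big1.
    by rewrite invr1 mul1r subrr.
  move=> a _; rewrite expr0n; case: eqP => [->|_] /=.
    by rewrite /P add0n gn mul1r.
  by rewrite mul0r mulr0 if_same.
- by rewrite expr0n mul0r.
move=> x x01; apply: le_trans (ler_norm_sum _ _ _) _.
have -> : N.+1%:R * x ^+ N * S = x ^+ N * (N.+1%:R * S) by ring.
have -> : N.+1%:R * S = \sum_c msum (fun a =>
   if ((msize a).+1 + msize g == n)%N then (mfac a)%:R^-1 *
      (`|mpow v (minc c a)| * Omega (madd (minc c a) g)) else 0).
  rewrite -(@msum_euler _ _ _ (fun k => (k + msize g == n)%N)
      (fun a => `|mpow v a| * Omega (madd a g))); last first.
    by move=> k /eqP <-; rewrite leq_addr.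
  rewrite /S msum_mulr; apply: eq_msum => a _; case: eqP => [E|_]; last by rewrite mulr0.
  by have -> : msize a = N.+1 by [rewrite -gN -E addnK]; rewrite mulrA.
rewrite mulr_sumr; apply: ler_sum => c _; rewrite normrM.
have := IH (minc c g) _ x; rewrite msize_minc gn' subnS gN /= => /(_ isT erefl x01) H.
apply: le_trans (ler_wpM2l (normr_ge0 _) H) _.
rewrite mulrCA ler_wpM2l ?exprn_ge0 //; first by case/andP: x01.
rewrite msum_mulr; apply: ler_msum => a; rewrite addnS addSn.
case: eqP => _; last by rewrite mulr0.
rewrite mpow_minc normrM.
have -> : madd (minc c a) g = madd a (minc c g).
  by apply/funext => c'; rewrite /madd /minc addnAC addnA.
by rewrite mulrCA !mulrA.
Qed.

End Taylor.
Arguments jet {R d} n D.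
Arguments taylor {R d} n D g xi z.

Section CellTaylor.
Context {R : realType} {d n : nat} (w : R) (hw : 0 < w).
Local Notation C := (option 'I_d).
Local Notation V := (R * 'rV[R]_d)%type.
Local Notation mindex := (C -> nat).
Local Notation msum := (@msum d n).
Variable D : mindex -> V -> R.
Hypothesis HD : jet n D.
Implicit Types (a b g : mindex) (c : C) (z v xi : V) (kappa : C -> int).

(** The averages are taken term by term, as in the operator; [cell_taylorE]
    exchanges the finite sum with the average. *)
Definition cell_taylor g kappa z : R := msum (fun a =>
  if (msize a + msize g <= n)%N then
    (mfac a)%:R^-1 *
      cell_average w kappa (fun xi => D (madd a g) xi * mpow (z - xi) a) else 0).

Lemma continuous_taylor_term a g z : (msize a + msize g <= n)%N ->
  continuous (fun xi => D (madd a g) xi * mpow (z - xi) a).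
Proof.
move=> H; apply: continuous_mul; first by apply: (jet_cont HD); rewrite msize_madd.
apply: continuous_bigprod => c _; apply: continuous_exp.
under eq_fun do rewrite coordB.
by move=> y; apply: cvgB; [exact: cvg_cst|exact: continuous_coord].
Qed.

Lemma cell_taylorE g kappa z :
  cell_taylor g kappa z = cell_average w kappa (fun xi => taylor n D g xi z).
Proof.
rewrite /cell_taylor /taylor msumE; under [X in cell_average _ _ X]eq_fun do rewrite msumE.
rewrite cell_average_sum // => [|b _].
  apply: eq_bigr => b _; case: ifP => H; last by rewrite cell_average_cst.
  by rewrite cell_averageZ //; exact: continuous_taylor_term.
case H: (msize (fun c => b c : nat) + msize g <= n)%N; last first.
  by move=> y; exact: cvg_cst.
apply: continuous_mul; first by move=> y; exact: cvg_cst.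
exact: continuous_taylor_term.
Qed.

Lemma continuous_taylor g z : continuous (fun xi => taylor n D g xi z).
Proof.
apply: continuous_msum => a; case H: (msize a + msize g <= n)%N; last first.
  by move=> y; exact: cvg_cst.
apply: continuous_mul; first by move=> y; exact: cvg_cst.
exact: continuous_taylor_term.
Qed.

Lemma cell_taylor_bound g kappa z (B : R) :
  (forall xi, (forall c, cell w (kappa c) (coord xi c)) ->
     `|D g z - taylor n D g xi z| <= B) ->
  `|D g z - cell_taylor g kappa z| <= B.
Proof.
move=> H.
have -> : D g z - cell_taylor g kappa z =
    cell_average w kappa (fun xi => -1 * taylor n D g xi z + D g z).
  rewrite cell_average_lin //; last by move=> y; exact: cvg_cst.
    by rewrite cell_average_cst // -cell_taylorE mulN1r addrC.
  exact: continuous_taylor.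
apply: cell_average_bound => //.
  apply: continuous_lincomb; first exact: continuous_taylor.
  by move=> y; exact: cvg_cst.
by move=> xi /H; rewrite mulN1r addrC.
Qed.

(** A partial derivative is the derivative in the corresponding coordinate, the
    others being held fixed. *)
Lemma is_derive_axisP (f : V -> R) z c (df : R) :
  is_derive (coord z c) (1 : R) (fun x => f (upd z c x)) df ->
  is_derive z (axis R c) f df.
Proof.
have E (x : R) : upd z c x = (z - coord z c *: axis R c) + x *: axis R c.
  by rewrite /upd scalerBl addrA addrAC.
under [X in is_derive _ _ X _]eq_fun do rewrite E.
by move/(is_derive_lineP f _ _ _ _).2; rewrite subrK.
Qed.

(** A monomial of index [a] loses one factor in the direction [c], and
    [a c / a!] is the inverse of the factorial of the lowered index: the sum is
    again a Taylor polynomial, that of the derivative in the direction [c]. For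
    [msize g = n] both sides vanish. *)
Lemma is_derive_cell_taylor g kappa z c :
  is_derive z (axis R c) (cell_taylor g kappa) (cell_taylor (minc c g) kappa z).
Proof.
pose P k := (k + msize g <= n)%N.
have Pn k : P k -> (k <= n)%N by apply: leq_trans; rewrite leq_addr.
apply: is_derive_eq.
  apply: (@is_derive_msum R d n _ _ (fun a => if P (msize a) then
    (a c)%:R / (mfac a)%:R * cell_average w kappa (fun xi =>
       D (madd (minc c (mdec c a)) g) xi * mpow (z - xi) (mdec c a)) else 0)) => a.
  rewrite -/(P (msize a)); case: ifP => H; last exact: is_derive_const.
  rewrite (mulrC (a c)%:R) -mulrA; apply: is_derive_scale.
  apply: is_derive_axisP.
  pose h xi := D (madd a g) xi *
    \prod_(c' | c' != c) coord (z - xi) c' ^+ a c'.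
  have E (x : R) : cell_average w kappa (fun xi => D (madd a g) xi * mpow (upd z c x - xi) a) =
     cell_average w kappa (fun xi => h xi * (x - coord xi c) ^+ a c).
    congr cell_average; apply/funext => xi; rewrite /h /mpow (bigD1 c) //=.
    rewrite coordB coord_upd eqxx (mulrC (_ ^+ _)) mulrA; congr (_ * _ * _).
    apply: eq_bigr => c' /negbTE cc'.
    by rewrite !coordB coord_upd eq_sym cc'.
  have ch : continuous h.
    apply: continuous_mul.
      by apply: (jet_cont HD); rewrite msize_madd.
    apply: continuous_bigprod => c' _.
    apply: continuous_exp; under eq_fun do rewrite coordB.
    by move=> y; apply: cvgB; [exact: cvg_cst|exact: continuous_coord].
  under [X in is_derive _ _ X _]eq_fun do rewrite E.
  apply: is_derive_eq; first exact: is_derive_cell_average.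
  case: (posnP (a c)) => [->|ac]; first by rewrite !mul0r.
  rewrite mdecK //; congr (_ * cell_average _ _ _); apply/funext => xi.
  rewrite /h /mpow -mulrA; congr (_ * _).
  rewrite [RHS](bigD1 c) //= mulrC coordB /mdec eqxx subn1; congr (_ * _).
  by apply: eq_bigr => c' /negbTE; rewrite eq_sym => ->; rewrite subn0.
rewrite (@msum_shift_fac d n R P (fun b => cell_average w kappa (fun xi =>
  D (madd (minc c b) g) xi * mpow (z - xi) b))) //.
apply: eq_msum => a _; rewrite /P msize_minc addnS addSn; case: ifP => // _.
congr (_ * cell_average _ _ _); apply/funext => xi; congr (D _ _ * _).
by apply/funext => c'; rewrite /madd /minc addnAC addnA.
Qed.

End CellTaylor.
Arguments cell_taylor {R d} n w D g kappa z.

(** * Unconditional sums and their termwise differentiation *)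

Section UnconditionalSums.
Context {R : realType} {I : choiceType}.
Implicit Types (a b : I -> R) (E F : {fset I}).

Definition abs_summable a : Prop :=
  exists B : R, forall E, \sum_(i <- E) `|a i| <= B.

Lemma sum_fsetD E F a : (E `<=` F)%fset ->
  \sum_(i <- F) a i = \sum_(i <- E) a i + \sum_(i <- (F `\` E)%fset) a i.
Proof.
move=> EF; rewrite (big_fsetID _ (mem E)) /=; congr (_ + _).
  by apply: eq_fbigl => i; rewrite !inE /= andb_idl // => /(fsubsetP EF).
by apply: eq_fbigl => i; rewrite !inE /= andbC.
Qed.

(** A supremum of the finite sums is nearly attained on some [E0], so that what
    lies outside of [E0] is small. *)
Lemma abs_summable_tail a (e : R) : abs_summable a -> 0 < e ->
  exists E0, forall E, (forall i, i \in E -> i \notin E0) ->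
    \sum_(i <- E) `|a i| <= e.
Proof.
move=> [B HB] e0.
pose S := [set \sum_(i <- E) `|a i| | E in [set: {fset I}]].
have Ssup : has_sup S.
  by split; [exists (\sum_(i <- fset0) `|a i|); exists fset0|exists B => _ [E _ <-]].
have [_ [E0 _ <-] HE0] := sup_adherent e0 Ssup.
exists E0 => E EE0.
have : \sum_(i <- (E0 `|` E)%fset) `|a i| <= sup S.
  by apply: sup_ubound; [case: Ssup|exists (E0 `|` E)%fset].
rewrite (@sum_fsetD E0) ?fsubsetUl // => H.
have -> : E = ((E0 `|` E) `\` E0)%fset.
  apply/fsetP => i; rewrite !inE; case iE0: (i \in E0) => //=.
  by apply/negbTE; apply: contraL iE0 => /EE0.
by lra.
Qed.

Lemma partial_sumE a E : summability.partial_sum a E = \sum_(i <- E) a i.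
Proof. by rewrite /summability.partial_sum big_seq_fsetE. Qed.

Lemma totallyP (P : {fset I} -> Prop) :
  (\forall E \near summability.totally, P E) <->
  exists E0, forall E, (E0 `<=` E)%fset -> P E.
Proof.
split; first by move=> [E0 _ H]; exists E0 => E /H.
by move=> [E0 H]; exists E0.
Qed.

Lemma abs_summable_cvg a : abs_summable a ->
  summability.partial_sum a @ summability.totally --> summability.sum (a : I -> R).
Proof.
move=> Sa; suff : cauchy (summability.partial_sum a @ summability.totally).
  by move/cauchy_cvg.
apply: cauchy_exP => e e0.
have e2 : 0 < e / 2 by rewrite divr_gt0.
have [E0 H] := abs_summable_tail Sa e2.
exists (summability.partial_sum a E0); apply/totallyP; exists E0 => E E0E.
rewrite /ball /= !partial_sumE (sum_fsetD _ E0E) opprD addrA subrr sub0r normrN.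
apply: le_lt_trans (ler_norm_sum _ _ _) _.
apply: (@le_lt_trans _ _ (e / 2)); last by rewrite ltr_pdivrMr // ltr_pMr // ltr1n.
by apply: H => i; rewrite inE => /andP [].
Qed.

(** The tail condition bears on signed sums: these are what the mean value
    theorem controls, since its intermediate point depends on the whole sum. *)
Lemma sum_approx a (e : R) E0 : abs_summable a ->
  (forall E, (forall i, i \in E -> i \notin E0) -> `|\sum_(i <- E) a i| <= e) ->
  `|summability.sum (a : I -> R) - \sum_(i <- E0) a i| <= e.
Proof.
move=> Sa H; apply/ler_addgt0Pr => h h0.
have /cvgrPdist_le /(_ _ h0) /totallyP [E1 H1] := abs_summable_cvg Sa.
have := H1 (E0 `|` E1)%fset (fsubsetUr _ _).
rewrite partial_sumE (@sum_fsetD E0) ?fsubsetUl //.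
set T := \sum_(i <- (_ `\` _)%fset) _ => H2.
have : `|T| <= e by apply: H => i; rewrite inE => /andP [].
rewrite !ler_norml => /andP [T1 T2]; move: H2; rewrite ler_norml => /andP [U1 U2].
by apply/andP; split; lra.
Qed.

Lemma norm_sum_le a (B : R) :
  (forall E, \sum_(i <- E) `|a i| <= B) -> `|summability.sum (a : I -> R)| <= B.
Proof.
move=> H; have := @sum_approx a B fset0; rewrite big_seq_fset0 subr0; apply.
  by exists B.
by move=> E _; apply: le_trans (H E); exact: ler_norm_sum.
Qed.

Lemma abs_summable_lin (c : R) a b : abs_summable a -> abs_summable b ->
  abs_summable (fun i => c * a i + b i).
Proof.
move=> [A HA] [B HB]; exists (`|c| * A + B) => E.
apply: le_trans (_ : \sum_(i <- E) (`|c| * `|a i| + `|b i|) <= _).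
  by apply: ler_sum => i _; rewrite -normrM; exact: ler_normD.
by rewrite big_split /= -mulr_sumr lerD // ler_wpM2l.
Qed.

Lemma sum_lin (c : R) a b : abs_summable a -> abs_summable b ->
  summability.sum (fun i => c * a i + b i) =
  c * summability.sum (a : I -> R) + summability.sum (b : I -> R).
Proof.
move=> Sa Sb; apply: cvg_lim => //.
have -> : summability.partial_sum (fun i => c * a i + b i) =
    fun E => c * summability.partial_sum a E + summability.partial_sum b E.
  by apply/funext => E; rewrite !partial_sumE big_split /= -mulr_sumr.
apply: cvgD; last exact: abs_summable_cvg.
by apply: cvgM; [exact: cvg_cst|exact: abs_summable_cvg].
Qed.

Lemma abs_summable_summable a : abs_summable a -> summable setT (EFin \o a).
Proof.
move=> [B HB]; rewrite /summable.
apply: (@le_lt_trans _ _ B%:E); last exact: ltry.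
apply: ge_ereal_sup => _ [A [finA _] <-].
by rewrite fsbig_finite //= sumEFin lee_fin HB.
Qed.

Lemma fset_sum_le_esum (f : I -> R) (S : set I) E : (forall i, 0 <= f i) ->
  (forall i, i \in E -> S i) ->
  ((\sum_(i <- E) f i)%:E <= \esum_(i in S) (f i)%:E)%E.
Proof.
move=> f0 ES; apply: esum_ge; exists [set` E].
  by split; [exact: finite_fset|move=> i /=; exact: ES].
by rewrite fsbig_finite //= set_fsetK -sumEFin.
Qed.

End UnconditionalSums.

(** Termwise differentiation of an unconditional sum: the mean value theorem is
    applied to finite partial sums, whose derivatives have a uniformly small
    tail. *)
Lemma is_derive_unconditional_sum (R : realType) (I : choiceType)
    (V : normedModType R) (F F' : I -> V -> R) (z v : V) :
  (forall i z, is_derive z v (F i) (F' i z)) ->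
  (forall z, abs_summable (F^~ z)) -> (forall z, abs_summable (F'^~ z)) ->
  (forall e : R, 0 < e -> exists2 r : R, 0 < r & exists E0 : {fset I},
     forall h : R, `|h| <= r -> forall E : {fset I},
     (forall i, i \in E -> i \notin E0) ->
     \sum_(i <- E) `|F' i (z + h *: v)| <= e) ->
  is_derive z v (fun z => summability.sum (F^~ z : I -> R))
    (summability.sum (F'^~ z : I -> R)).
Proof.
move=> HF SF SF' tail; apply/is_derive_epsP => e e0.
have e3 : 0 < e / 3 by rewrite divr_gt0.
have [r r0 [E0 HE0]] := tail _ e3.
have D0 : is_derive z v (fun z => \sum_(i <- E0) F i z) (\sum_(i <- E0) F' i z).
  exact: is_derive_bigsum.
have [q q0 Hq] := (is_derive_epsP _ _ _ _).1 D0 _ e3.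
exists (Num.min r q); first by rewrite lt_min r0.
move=> h; rewrite lt_min => /andP [hr hq].
pose G i := -1 * F i z + F i (z + h *: v).
have SG : abs_summable G by exact: abs_summable_lin.
have GE : summability.sum (G : I -> R) =
    summability.sum (F^~ (z + h *: v) : I -> R) - summability.sum (F^~ z : I -> R).
  by rewrite (sum_lin (-1) (SF z) (SF (z + h *: v))) mulN1r addrC.
have H1 : `|summability.sum (G : I -> R) - \sum_(i <- E0) G i| <= e / 3 * `|h|.
  apply: sum_approx => // E EE0.
  have DE (x : R) : is_derive x (1 : R) (fun s => \sum_(i <- E) F i (z + s *: v))
      (\sum_(i <- E) F' i (z + x *: v)).
    apply: is_derive_bigsum => i _; exact: (is_derive_lineP (F i) z v x _).1.
  have [s sh] := mean_value_increment DE 0 h.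
  rewrite !add0r scale0r addr0 => Es.
  have -> : \sum_(i <- E) G i = (\sum_(i <- E) F' i (z + s *: v)) * h.
    rewrite -Es -sumrB; apply: eq_bigr => i _.
    by rewrite /G mulN1r addrC.
  rewrite normrM ler_wpM2r //; apply: le_trans (ler_norm_sum _ _ _) _.
  by apply: HE0 => //; apply: le_trans sh _; exact: ltW.
have H2 : `|summability.sum (F'^~ z : I -> R) - \sum_(i <- E0) F' i z| <= e / 3.
  apply: sum_approx => // E EE0; apply: le_trans (ler_norm_sum _ _ _) _.
  have := HE0 0 _ E EE0; rewrite normr0 scale0r addr0; apply; exact: ltW.
have H3 := Hq h hq.
have GS : \sum_(i <- E0) G i = \sum_(i <- E0) F i (z + h *: v) - \sum_(i <- E0) F i z.
  by rewrite -sumrB; apply: eq_bigr => i _; rewrite /G mulN1r addrC.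
rewrite -GE.
set s' := summability.sum (F'^~ z : I -> R) in H2 *.
set t' := \sum_(i <- E0) F' i z in H2 H3 *.
have -> : summability.sum (G : I -> R) - h * s' =
   (summability.sum (G : I -> R) - \sum_(i <- E0) G i)
   + (\sum_(i <- E0) G i - h * t') - h * (s' - t') by ring.
apply: le_trans (ler_normB _ _) _.
apply: le_trans (lerD (ler_normD _ _) (lexx _)) _.
have -> : e * `|h| = e / 3 * `|h| + e / 3 * `|h| + `|h| * (e / 3) by field.
by rewrite GS in H1 *; rewrite normrM; apply: lerD; [exact: lerD|exact: ler_wpM2l].
Qed.

(** * Sums over the lattice and uniformly summable kernels *)

Section LatticeSums.
Context {R : realType} {d : nat}.
Local Notation C := (option 'I_d).
Local Notation I := (int * {ffun 'I_d -> int})%type.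
Implicit Types (E : {fset I}) (K : {fset int}).

Definition of_idx (f : C -> int) : I := (f None, [ffun i => f (Some i)]).

Lemma idxK (f : C -> int) c : idx (of_idx f) c = f c.
Proof. by case: c => [i|] //=; rewrite ffunE. Qed.

Lemma idx_inj (k l : I) : (forall c, idx k c = idx l c) -> k = l.
Proof.
case: k l => [k m] [l m'] H; congr pair; first exact: (H None).
by apply/ffunP => i; exact: (H (Some i)).
Qed.

(** A finite set of lattice points lies in a box, and over a box the sum of a
    product factors. *)
Lemma lattice_sum_le_prod E : exists K, forall h : C -> int -> R,
  (forall c k, 0 <= h c k) ->
  \sum_(i <- E) \prod_c h c (idx i c) <= \prod_c \sum_(k <- K) h c k.
Proof.
pose K : {fset int} := [fset k in 0 :: [seq idx i c | i <- enum_fset E, c <- enum {: C}]]%fset.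
have K0 : 0 \in K by rewrite !inE.
have EK i c : i \in E -> idx i c \in K.
  move=> iE; rewrite !inE; apply/orP; right.
  by apply/allpairsP; exists (i, c); rewrite mem_enum.
exists K => h h0.
under [leRHS]eq_bigr do rewrite big_seq_fsetE.
rewrite bigA_distr_bigA /=.
pose G (f : {ffun C -> K}) := \prod_c h c (val (f c)).
pose phi (i : I) : {ffun C -> K} := [ffun c => insubd [` K0]%fset (idx i c)].
have -> : \sum_(i <- E) \prod_c h c (idx i c) = \sum_(f <- [seq phi i | i <- E]) G f.
  rewrite big_map big_seq [RHS]big_seq; apply: eq_bigr => i iE.
  by apply: eq_bigr => c _; rewrite ffunE val_insubd EK.
have U : uniq [seq phi i | i <- E].
  rewrite map_inj_in_uniq ?fset_uniq // => i j iE jE /ffunP H.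
  by apply: idx_inj => c; have := congr1 val (H c); rewrite !ffunE !val_insubd !EK.
rewrite (big_uniq _ U) /= [leRHS](bigID (mem [seq phi i | i <- E])) /= lerDl.
by rewrite sumr_ge0 // => f _; exact: prodr_ge0.
Qed.

Definition box1 (m : nat) : {fset int} :=
  [fset (nat_of_ord i)%:Z - m%:Z | i in {: 'I_(m + m).+1}]%fset.

Definition box (m : nat) : {fset I} :=
  [fset of_idx (fun c => (nat_of_ord ((f : {ffun C -> 'I_(m + m).+1}) c))%:Z - m%:Z) | f in {: {ffun C -> 'I_(m + m).+1}}]%fset.

Lemma mem_box1 m (k : int) : (`|k| <= m)%N -> k \in box1 m.
Proof.
move=> km; have lt : (absz (k + m%:Z)%R < (m + m).+1)%N by lia.
apply/imfsetP; exists (Ordinal lt) => //=; lia.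
Qed.

Lemma mem_box m (i : I) : (forall c, (`|idx i c| <= m)%N) -> i \in box m.
Proof.
move=> im.
have lt c : (absz (idx i c + m%:Z)%R < (m + m).+1)%N by have := im c; lia.
apply/imfsetP; exists [ffun c => Ordinal (lt c)] => //=.
apply: idx_inj => c; rewrite idxK ffunE /=; have := im c; lia.
Qed.

Lemma box_sum_prod m (h : C -> int -> R) :
  \sum_(i <- box m) \prod_c h c (idx i c) = \prod_c \sum_(k <- box1 m) h c k.
Proof.
rewrite /box big_imfset /=; last first.
  move=> f g _ _ H; apply/ffunP => c; apply: val_inj.
  by have := congr1 (idx^~ c) H; rewrite !idxK => /addIr [].
under [RHS]eq_bigr => c _.
  rewrite big_imfset /=; last by move=> i j _ _ /addIr [] /val_inj.
  over.
rewrite big_enum /= (eq_bigr (fun c => \sum_(i < (m + m).+1) h c ((i : nat)%:Z - m%:Z))); last first.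
  by move=> c _; rewrite big_enum.
rewrite bigA_distr_bigA /=; apply: eq_bigr => f _; apply: eq_bigr => c _.
by rewrite idxK.
Qed.

Lemma cvg_box (a : I -> R) (s : R) :
  summability.partial_sum a @ summability.totally --> s ->
  (fun m => \sum_(i <- box m) a i) @ \oo --> s.
Proof.
move=> H; apply/cvgrPdist_le => e e0.
have /cvgrPdist_le /(_ _ e0) /totallyP [E0 HE] := H.
exists (\sum_(i <- E0) \sum_c `|idx i c|)%N => // m /= Hm.
rewrite -partial_sumE; apply: HE; apply/fsubsetP => i iE; apply: mem_box => c.
apply: leq_trans Hm; rewrite (big_fsetD1 i) //= (bigD1 c) //= -addnA; exact: leq_addr.
Qed.

Lemma cvg_box1 (a : int -> R) (s : R) :
  summability.partial_sum a @ summability.totally --> s ->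
  (fun m => \sum_(i <- box1 m) a i) @ \oo --> s.
Proof.
move=> H; apply/cvgrPdist_le => e e0.
have /cvgrPdist_le /(_ _ e0) /totallyP [E0 HE] := H.
exists (\sum_(i <- E0) `|i|)%N => // m /= Hm.
rewrite -partial_sumE; apply: HE; apply/fsubsetP => i iE; apply: mem_box1.
by apply: leq_trans Hm; rewrite (big_fsetD1 i) //= leq_addr.
Qed.

(** Boxes exhaust the lattice, and along them the sum of the product is the
    product of the sums. *)
Lemma lattice_sum_prod (h : C -> int -> R) (s : C -> R) :
  (forall c, summability.partial_sum (h c) @ summability.totally --> s c) ->
  abs_summable (fun i : I => \prod_c h c (idx i c)) ->
  summability.sum ((fun i => \prod_c h c (idx i c)) : I -> R) = \prod_c s c.
Proof.
move=> Hs Sh.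
have H1 := cvg_box (abs_summable_cvg Sh).
have H2 : (fun m => \sum_(i <- box m) \prod_c h c (idx i c)) @ \oo --> \prod_c s c.
  under eq_fun do rewrite box_sum_prod.
  elim: (index_enum _) => [|c r IH].
    rewrite big_nil (_ : (fun m => _) = fun=> 1); first exact: cvg_cst.
    by apply/funext => m; rewrite big_nil.
  rewrite big_cons (_ : (fun m => _) = fun m =>
    (\sum_(k <- box1 m) h c k) * \prod_(c <- r) \sum_(k <- box1 m) h c k).
    by apply: cvgM; [exact: cvg_box1|exact: IH].
  by apply/funext => m; rewrite big_cons.
by rewrite -(cvg_lim _ H1) // (cvg_lim _ H2).
Qed.

End LatticeSums.

Section TameFunctions.
Context {R : realType}.
Implicit Types (h chi : R -> R) (K : {fset int}).

(** What uniform convergence of a moment series provides. A normal convergence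
    (a summable majorant independent of [u]) would be too much to ask: the bumps
    of a kernel may sit at different places for different integers [k]. *)
Record tame h : Prop := Tame {
  tame_ge0 : forall u, 0 <= h u;
  tame_bounded : exists M : R, forall u K, \sum_(k <- K) h (u - k%:~R) <= M;
  tame_tail : forall e : R, 0 < e -> exists rho : R, forall u K,
    (forall k, k \in K -> rho <= `|u - k%:~R|) ->
    \sum_(k <- K) h (u - k%:~R) <= e }.

Lemma card_near_integers (u rho : R) K :
  (forall k, k \in K -> `|u - k%:~R| < rho) ->
  (size K <= 2 * `|Num.ceil rho| + 3)%N.
Proof.
move=> HK; set m := `|Num.ceil rho|%N.
pose s := [seq Num.floor u - (m.+1)%:Z + (i : nat)%:Z | i <- iota 0 (2 * m + 3)].
have -> : (2 * m + 3 = size s)%N by rewrite size_map size_iota.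
apply: uniq_leq_size; first exact: fset_uniq.
move=> k /HK kr; apply/mapP.
have rm : rho <= m%:R.
  have r0 : 0 < rho by apply: le_lt_trans kr.
  have := ceil_ge rho; move/le_trans; apply.
  by rewrite /m pmulrn ler_int abszE ler_norm.
have /andP [f1 f2] := floor_itv u.
have lo : Num.floor u - (m.+1)%:Z <= k.
  rewrite -(@ler_int R) rmorphB /=.
  move: kr; rewrite ltr_norml => /andP [k1 k2].
  rewrite -[(m.+1)%:Z]/(m.+1 : int) -pmulrn -natr1; lra.
have hi : k <= Num.floor u + (m.+1)%:Z.
  rewrite -(@ler_int R) rmorphD /=.
  move: kr; rewrite ltr_norml => /andP [k1 k2].
  move: f2; rewrite intrD /= => f2.
  rewrite -pmulrn -natr1; lra.
exists (absz (k - (Num.floor u - (m.+1)%:Z))%R); last by lia.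
rewrite mem_iota; lia.
Qed.

(** Near [u] there are boundedly many integers and the function is bounded; far
    from [u] the weight [(1 + t) ^+ n] is at most [2 ^+ n * t ^+ n]. *)
Lemma unif_moment_tame n chi : bounded_fun chi -> unif_moment_series n chi ->
  tame (fun u => (1 + `|u|) ^+ n * `|chi u|).
Proof.
move=> Bchi [_]; set F := (fun r : R => ereal_sup _) => tail.
have tail' (e : R) : 0 < e -> exists2 rho : R, 0 <= rho & forall u K,
    (forall k, k \in K -> rho <= `|u - k%:~R|) ->
    \sum_(k <- K) (1 + `|u - k%:~R|) ^+ n * `|chi (u - k%:~R)| <= e.
  move=> e0; have e2 : 0 < e / 2 ^+ n by rewrite divr_gt0 ?exprn_gt0.
  have : \forall r \near +oo, (F r < (e / 2 ^+ n)%:E)%E.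
    apply: (tail [set x | (x < (e / 2 ^+ n)%:E)%E]).
    by apply: open_nbhs_nbhs; split; [exact: open_ereal_lt_ereal|rewrite /= lte_fin].
  move=> [A [_ HA]].
  pose rho := Num.max 1 (A + 1).
  exists rho; first by rewrite le_max ler01.
  move=> u K HK.
  have := HA rho; rewrite lt_max ltrDl ltr01 orbT => /(_ isT) Hrho.
  have H : ((\sum_(k <- K) (`|u - k%:~R| ^+ n * `|chi (u - k%:~R)|))%:E <= (e / 2 ^+ n)%:E)%E.
    apply: le_trans (ltW Hrho).
    rewrite /F; apply: le_trans (ereal_sup_ubound _); last by exists u.
    by apply: fset_sum_le_esum => // k; rewrite mulr_ge0 // exprn_ge0.
  apply: (@le_trans _ _ (\sum_(k <- K) 2 ^+ n * (`|u - k%:~R| ^+ n * `|chi (u - k%:~R)|))).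
    rewrite big_seq [leRHS]big_seq; apply: ler_sum => k /HK kr.
    rewrite mulrA -exprMn ler_wpM2r // lerXn2r ?nnegrE ?addr_ge0 ?mulr_ge0 //.
    have : 1 <= `|u - k%:~R| by apply: le_trans kr; rewrite le_max lexx.
    by lra.
  by rewrite -mulr_sumr mulrC -ler_pdivlMr ?exprn_gt0 //; rewrite lee_fin in H.
split.
- by move=> u; rewrite mulr_ge0 // exprn_ge0 // addr_ge0.
- have [rho r0 Hr] := tail' 1 ltr01.
  have [B HB] : exists B : R, forall x, `|chi x| <= B.
    have [B0 [_ HB]] := Bchi; exists (B0 + 1) => x; apply: HB => //.
    by rewrite ltrDl.
  exists ((2 * `|Num.ceil rho| + 3)%:R * ((1 + rho) ^+ n * B) + 1) => u K.
  rewrite (big_fsetID _ (fun k : int => `|u - k%:~R| < rho)) /=; apply: lerD.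
    set K' := [fset _ | _ in _ & _]%fset.
    apply: (@le_trans _ _ (\sum_(k <- K') (1 + rho) ^+ n * B)).
      rewrite big_seq [leRHS]big_seq; apply: ler_sum => k; rewrite !inE /= => /andP [_ kr].
      apply: ler_pM => //; rewrite ?exprn_ge0 ?addr_ge0 //.
      by rewrite lerXn2r ?nnegrE ?addr_ge0 // lerD2l ltW.
    rewrite big_const_seq iter_addr addr0 -[leLHS]mulr_natl count_predT.
    apply: ler_wpM2r.
      by rewrite mulr_ge0 ?exprn_ge0 ?addr_ge0 // (le_trans _ (HB 0)).
    rewrite ler_nat; apply: (@card_near_integers u) => k.
    by rewrite !inE /= => /andP [_].
  by apply: Hr => k; rewrite !inE /= -leNgt => /andP [].
- by move=> e /tail' [rho _ H]; exists rho.
Qed.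

End TameFunctions.

(** * Differentiation of the operator *)

Section TameProducts.
Context {R : realType} {d : nat} (w : R) (hw : 0 < w).
Local Notation C := (option 'I_d).
Local Notation V := (R * 'rV[R]_d)%type.
Local Notation I := (int * {ffun 'I_d -> int})%type.
Variable h : C -> R -> R.
Hypothesis Hh : forall c, tame (h c).
Implicit Types (z : V) (E : {fset I}).

Lemma tame_prod_bounded : exists2 M : R, 1 <= M &
  (forall c u (K : {fset int}), \sum_(k <- K) h c (u - k%:~R) <= M) /\
  forall z E, \sum_(i <- E) \prod_c h c (w * coord z c - (idx i c)%:~R) <= M ^+ #|{: C}|.
Proof.
have [Mf HMf] := choice (fun c => tame_bounded (Hh c)).
pose M := 1 + \sum_c `|Mf c|.
have M1 : 1 <= M by rewrite lerDl sumr_ge0.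
have HM c u (K : {fset int}) : \sum_(k <- K) h c (u - k%:~R) <= M.
  apply: le_trans (HMf c u K) _; apply: le_trans (ler_norm _) _.
  by rewrite /M (bigD1 c) //= addrCA lerDl addr_ge0 // sumr_ge0.
exists M => //; split => // z E.
have [K HK] := @lattice_sum_le_prod R d E.
apply: le_trans (HK (fun c k => h c (w * coord z c - k%:~R)) _) _ => [c k|].
  exact: tame_ge0.
rewrite -prodr_const; apply: ler_prod => c _; rewrite HM andbT.
by apply: sumr_ge0 => k _; exact: tame_ge0.
Qed.

(** A lattice point outside a large box is far in some direction; there the sum
    is small, while it is bounded in all the others. *)
Lemma tame_prod_tail z (e : R) : 0 < e ->
  exists E0 : {fset I}, forall z', (forall c, `|coord z' c - coord z c| <= 1) ->
    forall E, (forall i, i \in E -> i \notin E0) ->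
    \sum_(i <- E) \prod_c h c (w * coord z' c - (idx i c)%:~R) <= e.
Proof.
move=> e0; have [M M1 [HM _]] := tame_prod_bounded.
have M0 : 0 < M by apply: lt_le_trans M1.
pose N := #|{: C}|.
have N0 : (0 < N)%N by apply/card_gt0P; exists None.
(* There are [N] directions in which a point can be far, and each of them
   contributes at most [e' * M ^+ N]. *)
pose e' := e / (N%:R * M ^+ N).
have e'0 : 0 < e' by rewrite divr_gt0 // mulr_gt0 ?ltr0n // exprn_gt0.
have [rf Hrf] := choice (fun c => tame_tail (Hh c) e'0).
pose r := \sum_c (`|rf c| + w + `|w * coord z c|).
exists (box `|Num.ceil r|) => z' Hz' E EE0.
have far i : i \in E -> exists c, rf c <= `|w * coord z' c - (idx i c)%:~R|.
  move=> /EE0 /negP iE; apply: contrapT => /forallNP near; apply: iE.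
  apply: mem_box => c.
  have kr : `|(idx i c)%:~R| <= r.
    have /negP := near c; rewrite -ltNge => H.
    have B1 : `|(idx i c)%:~R| <= `|rf c| + w + `|w * coord z c| :> R.
      have -> : (idx i c)%:~R = w * (coord z' c - coord z c) + w * coord z c
         - (w * coord z' c - (idx i c)%:~R) by ring.
      apply: le_trans (ler_normB _ _) _.
      apply: le_trans (lerD (ler_normD _ _) (lexx _)) _.
      have : `|w * (coord z' c - coord z c)| <= w.
        by rewrite normrM gtr0_norm // ler_piMr ?(ltW hw) // Hz'.
      have := ler_norm (rf c); have := ltW H; lra.
    apply: le_trans B1 _; rewrite /r (bigD1 c) //= lerDl sumr_ge0 // => c' _.
    by rewrite !addr_ge0 // ltW.
  rewrite -lez_nat -(@ler_int R) abszE intr_norm; apply: le_trans kr _.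
  apply: le_trans (ceil_ge r) _; rewrite ler_int abszE; exact: ler_norm.
have [K HK] := @lattice_sum_le_prod R d E.
(* The points that are far in the direction [c0] are selected by cutting off the
   factor of that direction. *)
pose hb c0 c (k : int) : R := h c (w * coord z' c - k%:~R) *
  (if c == c0 then (rf c <= `|w * coord z' c - k%:~R|)%R%:R else 1).
have hb0 c0 c k : 0 <= hb c0 c k.
  by rewrite /hb mulr_ge0 ?tame_ge0 //; case: ifP => _ //; exact: ler0n.
have S1 : \sum_(i <- E) \prod_c h c (w * coord z' c - (idx i c)%:~R) <=
   \sum_c0 \sum_(i <- E) \prod_c hb c0 c (idx i c).
  rewrite exchange_big /= big_seq [leRHS]big_seq; apply: ler_sum => i /far [c0 Hc0].
  apply: le_trans (_ : \prod_c hb c0 c (idx i c) <= _).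
    rewrite le_eqVlt; apply/orP; left; apply/eqP; apply: eq_bigr => c _.
    by rewrite /hb; case: eqP => [->|_]; rewrite ?Hc0 mulr1.
  by rewrite [leRHS](bigD1 c0) //= lerDl sumr_ge0 // => c _; exact: prodr_ge0.
apply: le_trans S1 _.
apply: le_trans (_ : \sum_(c0 : C) e' * M ^+ N <= _); last first.
  rewrite sumr_const -[leLHS]mulr_natl (_ : #|_| = N) // /e'.
  have N1 : N%:R != 0 :> R by rewrite pnatr_eq0 -lt0n.
  have M2 : M ^+ N != 0 by rewrite expf_neq0 // gt_eqF.
  by rewrite le_eqVlt; apply/orP; left; apply/eqP; field; rewrite N1 M2.
apply: ler_sum => c0 _; apply: le_trans (HK _ (hb0 c0)) _.
rewrite (bigD1 c0) //=; apply: ler_pM.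
- by apply: sumr_ge0.
- by apply: prodr_ge0 => c _; apply: sumr_ge0.
- apply: le_trans (Hrf c0 (w * coord z' c0)
    [fset k in K | rf c0 <= `|w * coord z' c0 - k%:~R|]%fset _); last first.
    by move=> k; rewrite !inE => /andP [].
  rewrite -big_fset_condE /= [leRHS]big_mkcond; apply: ler_sum => k _.
  by rewrite /hb eqxx; case: ifP => _; rewrite ?mulr1 ?mulr0.
- apply: le_trans (_ : \prod_(c | c != c0) M <= _).
    apply: ler_prod => c /negbTE cc0; rewrite sumr_ge0 //=.
    by rewrite /hb cc0; under eq_bigr do rewrite mulr1; exact: HM.
  rewrite prodr_const; apply: ler_weXn2l => //; exact: max_card.
Qed.

End TameProducts.

Section Operators.
Context {R : realType} {d n : nat} (w : R) (hw : 0 < w).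
Local Notation C := (option 'I_d).
Local Notation V := (R * 'rV[R]_d)%type.
Local Notation mindex := (C -> nat).
Local Notation I := (int * {ffun 'I_d -> int})%type.
Local Notation msum := (@msum d n).
Implicit Types (a b g q : mindex) (c : C) (z xi : V) (E : {fset I}) (i : I).
Variable chi : C -> R -> R.
Hypothesis chi_derive : forall c l x, (l < n)%N ->
  is_derive x (1 : R) (derive1n l (chi c)) (derive1n l.+1 (chi c) x).
Hypothesis chi_tame : forall c l, (l <= n)%N ->
  tame (fun u => (1 + `|u|) ^+ n * `|derive1n l (chi c) u|).

Definition weight b i z : R :=
  \prod_c derive1n (b c) (chi c) (w * coord z c - (idx i c)%:~R).

Lemma is_derive_weight b i z c : (b c < n)%N ->
  is_derive z (axis R c) (weight b i) (w * weight (minc c b) i z).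
Proof.
move=> bc; apply: is_derive_axisP.
pose P := \prod_(c' | c' != c) derive1n (b c') (chi c') (w * coord z c' - (idx i c')%:~R).
have E (x : R) : weight b i (upd z c x) =
    P * (derive1n (b c) (chi c) \o (fun x => w * x - (idx i c)%:~R)) x.
  rewrite /weight (bigD1 c) //= mulrC coord_upd eqxx; congr (_ * _).
  by apply: eq_bigr => c' /negbTE cc'; rewrite coord_upd eq_sym cc'.
under [X in is_derive _ _ X _]eq_fun do rewrite E.
have D1 : is_derive (coord z c) (1 : R) (fun x => w * x - (idx i c)%:~R) w.
  have := is_derive_sub (is_derive_scale w (is_derive_id (coord z c) (1 : R)))
    (is_derive_const ((idx i c)%:~R : R) (coord z c) 1).
  by rewrite subr0 mulr1.
apply: is_derive_eq.
  exact: (is_derive_scale P (is_derive1_comp (@chi_derive c (b c) _ bc) D1)).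
rewrite /weight (bigD1 c) // {1}/minc eqxx addn1.
have -> : \prod_(c' | c' != c) derive1n (minc c b c') (chi c')
    (w * coord z c' - (idx i c')%:~R) = P.
  by apply: eq_bigr => c' /negbTE; rewrite eq_sym /minc => ->; rewrite addn0.
by rewrite mulrC -mulrA mulrCA.
Qed.

Section Jet.
Variable D : mindex -> V -> R.
Hypothesis HD : jet n D.

Definition sk_term b g i z : R := weight b i z * cell_taylor n w D g (idx i) z.

(** The sampling Kantorovich operator with kernels derived [b] times, acting on
    the derivative [D g]. *)
Definition sk_op b g z : R := summability.sum (fun i => sk_term b g i z).

Lemma cell_dist i xi z c : cell w (idx i c) (coord xi c) ->
  w * `|coord z c - coord xi c| <= 1 + `|w * coord z c - (idx i c)%:~R|.
Proof.
move=> /cellP /andP []; rewrite ler_pdivrMr // ler_pdivlMr // intrD => c1 c2.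
rewrite -{1}(gtr0_norm hw) -normrM mulrBr.
have -> : w * coord z c - w * coord xi c =
  (idx i c)%:~R - coord xi c * w + (w * coord z c - (idx i c)%:~R) by ring.
apply: le_trans (ler_normD _ _) _; rewrite lerD2r ler_norml.
by apply/andP; split; lra.
Qed.

Lemma norm_mpow_le i xi z a : (forall c, cell w (idx i c) (coord xi c)) ->
  `|mpow (z - xi) a| <=
    w^-1 ^+ msize a * \prod_c (1 + `|w * coord z c - (idx i c)%:~R|) ^+ a c.
Proof.
move=> H; rewrite /mpow normr_prod /msize -prodrXr -big_split /=.
apply: ler_prod => c _; rewrite normr_ge0 /= normrX -exprMn lerXn2r ?nnegrE //.
  by rewrite mulr_ge0 ?invr_ge0 ?addr_ge0 // ltW.
by rewrite coordB mulrC ler_pdivlMr // mulrC; exact: cell_dist.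
Qed.

(** The derivatives of order less than [n] may be unbounded, but the Taylor
    polynomial is compared with the value of [D g] at [z], not in the cell: the
    growth in the cell comes from the remainder alone. *)
Lemma cell_taylor_growth g : (msize g <= n.+1)%N -> exists2 A : R, 0 <= A &
  forall i z, `|cell_taylor n w D g (idx i) z| <=
   ((if (msize g <= n)%N then `|D g z| else 0) + A) *
   \prod_c (1 + `|w * coord z c - (idx i c)%:~R|) ^+ n.
Proof.
have P1 i z : 1 <= \prod_c (1 + `|w * coord z c - (idx i c)%:~R|) ^+ n.
  elim/big_ind: _ => // [x y x1 y1|c _]; first exact: mulr_ege1.
  by rewrite exprn_ege1 // lerDl.
move=> gn1; have [gn|gn] := leqP (msize g) n; last first.
  exists 0 => // i z; rewrite (_ : cell_taylor _ _ _ _ _ _ = 0) ?normr0 ?addr0 ?mul0r //.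
  rewrite /cell_taylor msumE big1 // => b _; rewrite leqNgt ltn_addl //.
have /choice [Bf HB] : forall b, exists B : R, msize b = n -> forall z, `|D b z| <= B.
  move=> b; have [bn|bn] := eqVneq (msize b) n.
    by have [B HB] := jet_bounded HD bn; exists B.
  by exists 0 => /eqP; rewrite (negbTE bn).
pose A := msum (fun a => if (msize a + msize g == n)%N then
  (mfac a)%:R^-1 * (w^-1 ^+ msize a * (Bf (madd a g) + Bf (madd a g))) else 0).
have B0 b : msize b = n -> 0 <= Bf b by move=> /HB /(_ 0); apply: le_trans.
have A0 : 0 <= A.
  rewrite /A msumE sumr_ge0 // => a _; case: eqP => // E.
  have := B0 (madd (fun c => a c) g); rewrite msize_madd => /(_ E) H.
  by rewrite mulr_ge0 ?invr_ge0 // mulr_ge0 ?exprn_ge0 ?invr_ge0 ?addr_ge0 // ltW.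
exists A => // i z; set P := \prod_c _.
have : `|D g z - cell_taylor n w D g (idx i) z| <= A * P.
  apply: cell_taylor_bound => // xi Hxi.
  have T := @taylor_remainder R d n D HD xi (z - xi) (fun b => Bf b + Bf b) g 1 gn.
  have zE : xi + 1 *: (z - xi) = z by rewrite scale1r addrC subrK.
  rewrite zE expr1n mul1r ler01 lexx in T.
  apply: le_trans (T _ isT) _.
    by move=> b bn s _; apply: le_trans (ler_normB _ _) _; apply: lerD; exact: HB.
  rewrite /A mulrC msum_mulr; apply: ler_msum => a; case: eqP => [E|_]; last by rewrite mulr0.
  have B0a : 0 <= Bf (madd a g) by apply: B0; rewrite msize_madd.
  rewrite [leRHS]mulrCA ler_wpM2l ?invr_ge0 // mulrA [P * _]mulrC ler_wpM2r ?addr_ge0 //.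
  apply: le_trans (norm_mpow_le z a Hxi) _; rewrite ler_wpM2l ?exprn_ge0 ?invr_ge0 ?(ltW hw) //.
  apply: ler_prod => c _; rewrite exprn_ge0 ?addr_ge0 //=.
  rewrite ler_weXn2l ?lerDl //; apply: leq_trans (msize_ge a c) _.
  by rewrite -E leq_addr.
set T := cell_taylor _ _ _ _ _ _ => H.
have -> : T = D g z - (D g z - T) by ring.
apply: le_trans (ler_normB _ _) _; rewrite mulrDl lerD //.
by rewrite ler_peMr // P1.
Qed.

Lemma sk_term_growth b g : (msize g <= n.+1)%N -> exists2 A : R, 0 <= A &
  forall i z, `|sk_term b g i z| <= ((if (msize g <= n)%N then `|D g z| else 0) + A) *
   \prod_c ((1 + `|w * coord z c - (idx i c)%:~R|) ^+ n *
     `|derive1n (b c) (chi c) (w * coord z c - (idx i c)%:~R)|).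
Proof.
move=> /cell_taylor_growth [A A0 H]; exists A => // i z.
rewrite /sk_term normrM mulrC big_split /= mulrA /weight normr_prod.
by apply: ler_wpM2r => //; exact: prodr_ge0.
Qed.

Lemma sk_term_summable b g z : (forall c, (b c <= n)%N) -> (msize g <= n.+1)%N ->
  abs_summable (fun i => sk_term b g i z).
Proof.
move=> bn /(sk_term_growth b) [A A0 H].
have [M M1 [_ HM]] := @tame_prod_bounded R d w _ (fun c => chi_tame c (bn c)).
have X0 z' : 0 <= (if (msize g <= n)%N then `|D g z'| else 0) + A.
  by rewrite addr_ge0 //; case: ifP.
exists (((if (msize g <= n)%N then `|D g z| else 0) + A) * M ^+ #|{: C}|) => E.
apply: le_trans (ler_sum _ (fun i _ => H i z)) _; rewrite -mulr_sumr.
by apply: ler_wpM2l => //; exact: (HM z E).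
Qed.

(** Locally uniform in the direction of differentiation, because [D g] is locally
    bounded and the kernels have uniform tails. *)
Lemma sk_term_tail b g z c (e : R) : 0 < e ->
  (forall c, (b c <= n)%N) -> (msize g <= n.+1)%N ->
  exists2 r : R, 0 < r & exists E0 : {fset I}, forall t : R, `|t| <= r -> forall E,
    (forall i, i \in E -> i \notin E0) ->
    \sum_(i <- E) `|sk_term b g i (z + t *: axis R c)| <= e.
Proof.
move=> e0 bn gn1; have [A A0 H] := sk_term_growth b gn1.
pose X z' := if (msize g <= n)%N then `|D g z'| else 0.
have [r r0 Hr] : exists2 r : R, 0 < r & forall z', (forall c, `|coord z' c - coord z c| < r) ->
    X z' <= X z + 1.
  rewrite /X; case gn: (msize g <= n)%N; last by exists 1 => // z' _; rewrite add0r.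
  have : \forall y \near z, `|D g z - D g y| < 1.
    by move: (@jet_cont _ _ _ _ HD g gn z) => /cvgrPdist_lt; apply.
  rewrite near_coordP => -[r r0 Hr]; exists r => // z' /Hr /ltW L.
  have -> : D g z' = D g z - (D g z - D g z') by ring.
  by apply: le_trans (ler_normB _ _) _; rewrite lerD2l.
have X1 : 0 < X z + 1 + A by rewrite ltr_wpDr // ltr_wpDl // /X; case: ifP.
have e1 : 0 < e / (X z + 1 + A) by rewrite divr_gt0.
have [E0 HE0] := @tame_prod_tail R d w hw _ (fun c => chi_tame c (bn c)) z _ e1.
exists (Num.min (r / 2) 1); first by rewrite lt_min divr_gt0 /=.
exists E0 => t; rewrite le_min => /andP [tr t1] E EE0.
have dist c' : `|coord (z + t *: axis R c) c' - coord z c'| <= `|t|.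
  rewrite coord_shift addrC addKr normrM ler_piMr //.
  by case: eqP; rewrite ?normr1 ?normr0.
apply: le_trans (ler_sum _ (fun i _ => H i (z + t *: axis R c))) _; rewrite -mulr_sumr.
have -> : e = (X z + 1 + A) * (e / (X z + 1 + A)) by rewrite mulrC mulfVK // gt_eqF.
have X0 z' : 0 <= X z' by rewrite /X; case: ifP.
apply: ler_pM.
- by rewrite addr_ge0 // X0.
- apply: sumr_ge0 => i _; apply: prodr_ge0 => c' _.
  by rewrite mulr_ge0 // exprn_ge0 // addr_ge0.
- rewrite lerD2r; apply: Hr => c'; apply: le_lt_trans (dist c') _.
  by apply: le_lt_trans tr _; rewrite ltr_pdivrMr // ltr_pMr // ltr1n.
- by apply: HE0 => // c'; apply: le_trans (dist c') _.
Qed.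

Lemma is_derive_sk_op b g z c :
  (forall c, (b c <= n)%N) -> (b c < n)%N -> (msize g <= n)%N ->
  is_derive z (axis R c) (sk_op b g) (w * sk_op (minc c b) g z + sk_op b (minc c g) z).
Proof.
move=> bn bc gn.
have bn' c' : (minc c b c' <= n)%N.
  by rewrite /minc; case: eqP => [<-|_]; rewrite ?addn1 ?addn0.
have gn1 : (msize g <= n.+1)%N by rewrite leqW.
have gn2 : (msize (minc c g) <= n.+1)%N by rewrite msize_minc.
have S z' := sk_term_summable z' bn gn1.
have S1 z' := sk_term_summable z' bn' gn1.
have S2 z' := sk_term_summable z' bn gn2.
rewrite /sk_op -sum_lin //.
apply: (@is_derive_unconditional_sum R _ _ (sk_term b g)
  (fun i z => w * sk_term (minc c b) g i z + sk_term b (minc c g) i z)) => //.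
- move=> i z'; apply: is_derive_eq.
    by apply: is_derive_mul; [exact: is_derive_weight|exact: is_derive_cell_taylor].
  by rewrite /sk_term; ring.
- by move=> z'; exact: abs_summable_lin.
move=> e e0.
have e1 : 0 < e / 2 / w by rewrite !divr_gt0.
have e2 : 0 < e / 2 by rewrite divr_gt0.
have [r1 r10 [E1 H1]] := sk_term_tail z c e1 bn' gn1.
have [r2 r20 [E2 H2]] := sk_term_tail z c e2 bn gn2.
exists (Num.min r1 r2); first by rewrite lt_min r10.
exists (E1 `|` E2)%fset => t; rewrite le_min => /andP [tr1 tr2] E EE.
apply: le_trans (_ : \sum_(i <- E) (w * `|sk_term (minc c b) g i (z + t *: axis R c)|
   + `|sk_term b (minc c g) i (z + t *: axis R c)|) <= _).
  apply: ler_sum => i _; apply: le_trans (ler_normD _ _) _.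
  by rewrite normrM gtr0_norm.
rewrite big_split /= -mulr_sumr [e]splitr; apply: lerD.
  rewrite mulrC -ler_pdivlMr //; apply: H1 => // i /EE.
  by rewrite inE negb_or => /andP [].
by apply: H2 => // i /EE; rewrite inE negb_or => /andP [].
Qed.

(** Each derivative falls either on a kernel, with a factor [w], or on the
    averaged Taylor polynomials. *)
Definition leibniz q z : R := msum (fun b =>
  (mbin q b)%:R * w ^+ msize b * sk_op b (msub q b) z).

(** Pascal's rule, after the terms in which a kernel has been derived are
    reindexed by [minc c]. *)
Lemma is_derive_leibniz q z c : (msize q < n)%N ->
  is_derive z (axis R c) (leibniz q) (leibniz (minc c q) z).
Proof.
move=> qn; apply: is_derive_eq.
  apply: (@is_derive_msum _ _ _ _ _ (fun b => (mbin q b)%:R * w ^+ msize b *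
    (w * sk_op (minc c b) (msub q b) z + sk_op b (minc c (msub q b)) z))) => b.
  have [->|b0] := eqVneq (mbin q b) 0%N.
    under [X in is_derive _ _ X _]eq_fun do rewrite !mul0r.
    by rewrite !mul0r; exact: is_derive_const.
  have bq := mbin_neq0 b0.
  have bn c' : (b c' < n)%N by apply: leq_ltn_trans (bq c') _;
    apply: leq_ltn_trans qn; exact: msize_ge.
  apply: is_derive_scale; apply: is_derive_sk_op => // [c'|]; first exact: ltnW.
  apply: leq_trans (ltnW qn); apply: leq_sum => c' _; exact: leq_subr.
rewrite /leibniz; move: sk_op => S.
under eq_msum => b _ do rewrite mulrDr.
rewrite msumD (@msum_shift _ _ _ (fun b => _ * (w * _)) c); last first.
  move=> b _ bc; rewrite (_ : mbin q b = 0%N) ?mul0r //.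
  apply/eqP/negPn/negP => /mbin_neq0 /(_ c); rewrite bc leqNgt => /negP; apply.
  by apply: leq_ltn_trans qn; exact: msize_ge.
rewrite -msumD; apply: eq_msum => b _; rewrite mbin_minc natrD natrM !mulrDl addrC.
have -> : (mbin q b)%:R * w ^+ msize b * S b (minc c (msub q b)) z =
    (mbin q b)%:R * w ^+ msize b * S b (msub (minc c q) b) z.
  have [->|b0] := eqVneq (mbin q b) 0%N; first by rewrite !mul0r.
  rewrite (_ : minc c (msub q b) = msub (minc c q) b) //.
  by apply/funext => c'; rewrite /minc /msub addnBAC // (mbin_neq0 b0).
case: (posnP (b c)) => [_|bc]; first by rewrite !mul0r.
rewrite mul1r mdecK // -(msize_mdec bc) exprSr.
have -> : msub q (mdec c b) = msub (minc c q) b; last by rewrite !mulrA.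
apply/funext => c'; rewrite /msub /mdec /minc; case: eqP => [E|_]; last by rewrite subn0 addn0.
by rewrite -E; lia.
Qed.

End Jet.
End Operators.
Arguments sk_term {R d} n w chi D b g i z.
Arguments sk_op {R d} n w chi D b g z.
Arguments leibniz {R d} n w chi D q z.

(** * Jets of regular functions and sums of the weights *)

Section IteratedPartials.
Context {R : realType} {d : nat}.
Local Notation C := (option 'I_d).
Local Notation V := (R * 'rV[R]_d)%type.
Implicit Types (s t : seq C) (c : C).

Definition mdirs_of (g : C -> nat) : seq C := mdirs (g None) (fun i => g (Some i)).

Lemma count_mdirs_of g c : count_mem c (mdirs_of g) = g c.
Proof.
rewrite /mdirs_of /mdirs count_cat count_nseq count_flatten -map_comp sumnE big_map.
rewrite big_enum /=; under eq_bigr do rewrite /= count_nseq.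
case: c => [i|] /=; last by rewrite mul1n big1 ?addn0.
rewrite mul0n add0n (bigD1 i) //= eqxx mul1n big1 ?addn0 // => j /negbTE ji.
by rewrite (inj_eq Some_inj) ji.
Qed.

Lemma size_mdirs_of g : size (mdirs_of g) = msize g.
Proof.
rewrite /mdirs_of /mdirs size_cat size_nseq size_flatten /shape -map_comp sumnE big_map.
by rewrite big_enum /msize big_option /=; congr addn; apply: eq_bigr => i _; rewrite /= size_nseq.
Qed.

Section Regular.
Variables (n : nat) (f : V -> R).
Hypothesis f_Cn : in_Cn n f.

Lemma is_derive_partials s c z : (size s < n)%N ->
  is_derive z (axis R c) (partials s f) (partials (c :: s) f z).
Proof.
move=> sn; have [H _] := f_Cn.1 (c :: s) sn.
by apply: derivableP; apply: H; exact: suffix_refl.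
Qed.

Lemma continuous_partials s : (size s <= n)%N -> continuous (partials s f).
Proof. by move=> sn; have [_] := f_Cn.1 s sn. Qed.

Lemma partials_swap s c c' : ((size s).+2 <= n)%N ->
  partials (c :: c' :: s) f = partials (c' :: c :: s) f.
Proof.
move=> sn; have sn1 : ((size s).+1 < n)%N by [].
have sn0 : (size s < n)%N by exact: ltnW.
apply: (@mixed_partials_comm R d (partials s f) (partials (c' :: s) f)
  (partials (c :: s) f) _ _ c' c) => [z|z|z|z||].
- exact: is_derive_partials.
- exact: is_derive_partials.
- exact: is_derive_partials.
- exact: is_derive_partials.
- exact: continuous_partials.
- exact: continuous_partials.
Qed.

Lemma partials_move s1 s2 c : ((size (s1 ++ s2)).+1 <= n)%N ->
  partials (s1 ++ c :: s2) f = partials (c :: s1 ++ s2) f.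
Proof.
elim: s1 => [//|x s1 IH] /= sn.
transitivity (partials (x :: c :: s1 ++ s2) f); last exact: partials_swap.
by rewrite /= IH // ltnW.
Qed.

Lemma partials_perm s s' : (size s <= n)%N -> perm_eq s s' ->
  partials s f = partials s' f.
Proof.
elim: s s' => [|c s IH] s' sn ss'.
  by move: ss'; rewrite perm_sym => /perm_nilP ->.
have cs' : c \in s' by rewrite -(perm_mem ss') inE eqxx.
case/splitPr: cs' ss' => s1 s2 ss'.
have ss : perm_eq s (s1 ++ s2).
  by move: ss'; rewrite (perm_sym (c :: s)) perm_catC /= perm_cons perm_catC perm_sym.
rewrite partials_move -?(perm_size ss) //=.
by rewrite (IH _ (ltnW sn) ss).
Qed.

(** By the symmetry of derivatives, the iterated partial derivatives of [f]
    depend only on the multi-index. *)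
Lemma jet_mpartial : jet n (fun g => partials (mdirs_of g) f).
Proof.
split=> [g gn|g c z gn|g gn].
- by apply: continuous_partials; rewrite size_mdirs_of.
- have -> : partials (mdirs_of (minc c g)) f = partials (c :: mdirs_of g) f.
    apply: partials_perm; first by rewrite size_mdirs_of msize_minc.
    apply/allP => c' _ /=; apply/eqP; rewrite !count_mdirs_of /minc addnC.
    by rewrite /= eq_sym.
  by apply: is_derive_partials; rewrite size_mdirs_of.
- have [_ [B [_ HB]]] := f_Cn.2 _ (etrans (size_mdirs_of g) gn).
  by exists (B + 1) => z; apply: HB => //; rewrite ltrDl.
Qed.

End Regular.
End IteratedPartials.

Section KernelSums.
Context {R : realType} {d n : nat} (w : R) (hw : 0 < w).
Local Notation C := (option 'I_d).
Local Notation V := (R * 'rV[R]_d)%type.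
Local Notation mindex := (C -> nat).
Local Notation I := (int * {ffun 'I_d -> int})%type.
Variable chi : C -> R -> R.
Hypothesis chi_derive : forall c l x, (l < n)%N ->
  is_derive x (1 : R) (derive1n l (chi c)) (derive1n l.+1 (chi c) x).
Hypothesis chi_tame : forall c l, (l <= n)%N ->
  tame (fun u => (1 + `|u|) ^+ n * `|derive1n l (chi c) u|).
Hypothesis chi_sum : forall c u,
  summability.partial_sum (fun k : int => chi c (u - k%:~R)) @ summability.totally --> (1 : R).

(** The jet of the constant function 1. *)
Definition jet_one (g : mindex) : V -> R := fun=> (msize g == 0%N)%:R.

Lemma jet_jet_one : jet n jet_one.
Proof.
split=> [g _|g c z _|g _]; first by move=> z; exact: cvg_cst.
- by rewrite /jet_one msize_minc; exact: is_derive_const.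
- by exists 1 => z; rewrite /jet_one; case: eqP; rewrite ?normr1 ?normr0.
Qed.

Lemma cell_taylor_one g (kappa : C -> int) z :
  cell_taylor n w jet_one g kappa z = (msize g == 0%N)%:R.
Proof.
have E a : cell_average w kappa (fun xi : V => jet_one (madd a g) xi * mpow (z - xi) a) =
    (msize a + msize g == 0)%N%:R.
  rewrite /jet_one msize_madd; case: eqP => [|_].
    move/eqP; rewrite addn_eq0 => /andP [/eqP /msize_eq0 -> _].
    under eq_fun do rewrite mpow_mzero mulr1.
    exact: cell_average_cst.
  under eq_fun do rewrite mul0r.
  exact: cell_average_cst.
rewrite /cell_taylor (@eq_msum _ _ _ _ (fun a => if msize a == 0%N then
   (msize g == 0%N)%:R else 0)) ?msum_pick0 // => a _.
rewrite E addn_eq0; case: (eqVneq (msize a) 0%N) => [a0|a0] /=; last first.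
  by rewrite mulr0 if_same.
rewrite (msize_eq0 a0) msize_mzero add0n /mfac big1 // invr1 mul1r.
by case: eqP => [->|_] //=; rewrite if_same.
Qed.

(** For [b = 0] the sum is a product of partitions of unity. It is also the
    operator applied to the constant 1, so the other cases follow by induction
    from the differentiability of the operator: the derivative of a constant
    vanishes. *)
Lemma weight_sum (b : mindex) z : (msize b <= n)%N ->
  summability.sum ((fun i => weight w chi b i z) : I -> R) = (msize b == 0%N)%:R.
Proof.
have T1 b' z' : sk_term n w chi jet_one b' mzero ^~ z' = fun i => weight w chi b' i z'.
  by apply/funext => i; rewrite /sk_term cell_taylor_one msize_mzero mulr1.
have O1 b' : sk_op n w chi jet_one b' mzero =
    fun z => summability.sum ((fun i => weight w chi b' i z) : I -> R).
  by apply/funext => z'; rewrite /sk_op T1.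
move: {2}(msize b) (erefl (msize b)) => N; elim: N b z => [|N IH] b z bN bn.
  rewrite bN eqxx (msize_eq0 bN).
  have S0 : abs_summable (fun i => weight w chi mzero i z).
    rewrite -[X in abs_summable X](T1 mzero z).
    by apply: (sk_term_summable hw chi_tame jet_jet_one) => //; rewrite msize_mzero.
  have := @lattice_sum_prod R d (fun c k => chi c (w * coord z c - k%:~R)) (fun=> 1)
    (fun c => chi_sum c _) S0.
  by rewrite big1.
have [c bc] : exists c, (0 < b c)%N.
  apply: contrapT => /forallNP H; move: bN; rewrite /msize big1 // => c _.
  by apply/eqP; rewrite -leqn0 leqNgt; apply/negP/H.
rewrite bN /=; set b' := mdec c b.
have bE : b = minc c b' by rewrite mdecK.
have b'N : msize b' = N by apply: succn_inj; rewrite msize_mdec.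
have b'n : (msize b' < n)%N by rewrite b'N -bN.
have b'c c' : (b' c' < n)%N by apply: leq_ltn_trans b'n; exact: msize_ge.
have := is_derive_sk_op hw chi_derive chi_tame jet_jet_one z
  (fun c => ltnW (b'c c)) (b'c c) (_ : (msize (@mzero d) <= n)%N).
rewrite msize_mzero => /(_ isT).
have -> : sk_op n w chi jet_one b' (minc c mzero) z = 0.
  rewrite /sk_op (_ : sk_term _ _ _ _ _ _ ^~ z = fun=> 0).
    apply/eqP; rewrite -normr_le0; apply: norm_sum_le => E.
    by rewrite big1 // => i _; rewrite normr0.
  by apply/funext => i; rewrite /sk_term cell_taylor_one msize_minc mulr0.
rewrite addr0 -bE !O1.
rewrite (_ : (fun z => _) = fun=> (msize b' == 0%N)%:R); last first.
  by apply/funext => z'; rewrite IH // ltnW.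
move=> /@derive_val; have /@derive_val -> := is_derive_const ((msize b' == 0%N)%:R : R) z (axis R c).
by move/esym/eqP; rewrite mulf_eq0 gt_eqF //= => /eqP.
Qed.

Variable D : mindex -> V -> R.
Hypothesis HD : jet n D.

(** By [weight_sum] the value [D g z] can be distributed over the cells, which
    leaves the weighted sum of the remainders. *)
Lemma sk_op_error (b g : mindex) z (B : R) : (msize b + msize g <= n)%N ->
  (forall E : {fset I}, \sum_(i <- E) `|weight w chi b i z| *
     `|D g z - cell_taylor n w D g (idx i) z| <= B) ->
  `|sk_op n w chi D b g z - (msize b == 0%N)%:R * D g z| <= B.
Proof.
move=> bgn HB.
have bn : (msize b <= n)%N by apply: leq_trans bgn; exact: leq_addr.
have gn : (msize g <= n)%N by apply: leq_trans bgn; exact: leq_addl.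
have b1 c : (b c <= n)%N by apply: leq_trans bn; exact: msize_ge.
have S1 : abs_summable (fun i => sk_term n w chi D b g i z).
  by apply: (sk_term_summable hw chi_tame HD) => //; exact: leqW.
have S2 : abs_summable (fun i => weight w chi b i z).
  have := sk_term_summable hw chi_tame jet_jet_one z b1 (_ : (msize (@mzero d) <= n.+1)%N).
  rewrite msize_mzero => /(_ isT); congr abs_summable.
  by apply/funext => i; rewrite /sk_term cell_taylor_one msize_mzero mulr1.
rewrite -(weight_sum z bn) [X in _ - X]mulrC -mulNr addrC /sk_op -sum_lin //.
apply: norm_sum_le => E; apply: le_trans (HB E).
apply: ler_sum => i _.
have -> : - D g z * weight w chi b i z + sk_term n w chi D b g i z =
  - (weight w chi b i z * (D g z - cell_taylor n w D g (idx i) z)).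
  by rewrite /sk_term; ring.
by rewrite normrN normrM.
Qed.

End KernelSums.

(** * The error estimate *)

Section Modulus.
Context {R : realType} {d : nat}.
Local Notation C := (option 'I_d).
Local Notation V := (R * 'rV[R]_d)%type.
Implicit Types (g : V -> R) (xi v : V) (h : R).

Lemma modulus_ge0 g h : 0 < h -> (0 <= modulus g h (fun=> h))%E.
Proof.
move=> h0; apply: ereal_sup_ubound; exists 0, 0.
by split=> [|i|]; rewrite ?subrr ?normr0.
Qed.

Lemma modulus_fin g h (B : R) : 0 < h -> (forall z, `|g z| <= B) ->
  modulus g h (fun=> h) \is a fin_num.
Proof.
move=> h0 HB; rewrite ge0_fin_numE; last exact: modulus_ge0.
apply: (@le_lt_trans _ _ (B + B)%:E); last exact: ltry.
apply: ge_ereal_sup => _ [z [t [_ _ ->]]]; rewrite lee_fin.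
by apply: le_trans (ler_normB _ _) _; apply: lerD.
Qed.

Lemma le_modulus g h xi v : modulus g h (fun=> h) \is a fin_num ->
  (forall c, `|coord xi c - coord v c| < h) ->
  `|g xi - g v| <= fine (modulus g h (fun=> h)).
Proof.
move=> mfin H; rewrite -lee_fin fineK //; apply: ereal_sup_ubound.
by exists xi, v; split=> [|i|//]; [exact: (H None)|exact: (H (Some i))].
Qed.

(** A segment is cut into so many equal pieces that each is shorter than
    [w^-1] in every direction; [\prod_c (1 + w * `|coord v c|)] pieces suffice. *)
Lemma modulus_segment g (w s : R) xi v : 0 < w -> 0 <= s <= 1 ->
  modulus g w^-1 (fun=> w^-1) \is a fin_num ->
  `|g (xi + s *: v) - g xi| <=
    fine (modulus g w^-1 (fun=> w^-1)) * \prod_c (1 + w * `|coord v c|).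
Proof.
move=> w0 /andP [s0 s1] mfin; set om := fine _; set P := \prod_c _.
have om0 : 0 <= om by rewrite fine_ge0 // modulus_ge0 // invr_gt0.
have P1 c : 1 + w * `|coord v c| <= P.
  rewrite /P (bigD1 c) //= ler_peMr ?addr_ge0 ?mulr_ge0 ?(ltW w0) //.
  elim/big_ind: _ => // [x y|c' _]; first exact: mulr_ege1.
  by rewrite lerDl mulr_ge0 // ltW.
pose L := Num.truncn P.
have P0 : 0 <= P by apply: le_trans (P1 None); rewrite addr_ge0 // mulr_ge0 // ltW.
have /andP [L1 L2] := truncn_itv P0.
have Lv c : w * `|coord v c| < L%:R.
  by have := P1 c; move: L2; rewrite -natr1 -/L; lra.
have L0 : 0 < L%:R :> R by apply: le_lt_trans (Lv None); rewrite mulr_ge0 // ltW.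
pose y (k : nat) := xi + (k%:R * (s / L%:R)) *: v.
have -> : g (xi + s *: v) - g xi = \sum_(0 <= k < L) (g (y k.+1) - g (y k)).
  rewrite telescope_sumr // /y mul0r scale0r addr0.
  by rewrite mulrCA mulfV ?gt_eqF // mulr1.
apply: le_trans (ler_norm_sum _ _ _) _.
apply: le_trans (_ : \sum_(0 <= k < L) om <= _).
  apply: ler_sum => k _; apply: le_modulus => // c.
  rewrite /y !coordD !coordZ -natr1.
  have -> : coord xi c + (k%:R + 1) * (s / L%:R) * coord v c
    - (coord xi c + k%:R * (s / L%:R) * coord v c) = s * coord v c / L%:R by ring.
  rewrite !normrM (ger0_norm s0) normfV (gtr0_norm L0) ltr_pdivrMr //.
  rewrite [ltRHS]mulrC ltr_pdivlMr // -mulrA (mulrC _ w).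
  by apply: le_lt_trans (Lv c); rewrite ler_piMl // mulr_ge0 // ltW.
rewrite big_const_nat subn0 iter_addr addr0 -mulr_natr.
by apply: ler_wpM2l.
Qed.

End Modulus.

Section MomentBounds.
Context {R : realType}.
Implicit Types (chi : R -> R) (K : {fset int}).

Lemma abs_moment_ge0 (m : R) chi : (0 <= abs_moment m chi)%E.
Proof.
apply: (@le_trans _ _ (\esum_(k in [set: int])
  (`|0 - k%:~R| `^ m * `|chi (0 - k%:~R)|)%:E)%E).
  by apply: esum_ge0 => k _; rewrite lee_fin mulr_ge0 // powR_ge0.
by apply: ereal_sup_ubound; exists 0.
Qed.

Lemma le_abs_moment (m : nat) chi (u : R) K :
  ((\sum_(k <- K) `|u - k%:~R| ^+ m * `|chi (u - k%:~R)|)%:E <= abs_moment m%:R chi)%E.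
Proof.
apply: le_trans (ereal_sup_ubound _); last by exists u.
under [X in (X%:E <= _)%E]eq_bigr do rewrite -powR_mulrn //.
apply: fset_sum_le_esum => // k; by rewrite mulr_ge0 // powR_ge0.
Qed.

Lemma moment_factor_ge0 l chi : (0 <= moment_factor l chi)%E.
Proof.
by rewrite /moment_factor !adde_ge0 // ?mule_ge0 ?lee_fin // ?abs_moment_ge0.
Qed.

(** Convexity of the power function. *)
Lemma exprD1_le (t : R) l : 0 <= t -> (1 + t) ^+ l <= 2 ^+ l / 2 * (1 + t ^+ l).
Proof.
move=> t0; elim: l => [|l IH]; first by rewrite !expr0; lra.
have tl : 0 <= t ^+ l by rewrite exprn_ge0.
have key : t ^+ l + t <= 1 + t ^+ l * t.
  suff : 0 <= (1 - t ^+ l) * (1 - t) by lra.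
  have [t1|t1] := leP t 1.
    by rewrite mulr_ge0 // subr_ge0 // exprn_ile1.
  by rewrite mulr_le0 // subr_le0 ?exprn_ege1 // ltW.
rewrite exprSr; apply: le_trans (ler_wpM2r _ IH) _; first by rewrite addr_ge0.
rewrite [2 ^+ l.+1]exprSr exprSr.
have p0 : 0 <= (2 : R) ^+ l by rewrite exprn_ge0.
have -> : 2 ^+ l / 2 * (1 + t ^+ l) * (1 + t) =
  2 ^+ l * ((1 + t ^+ l) * (1 + t) / 2) by ring.
have -> : 2 ^+ l * 2 / 2 * (1 + t ^+ l * t) = 2 ^+ l * (1 + t ^+ l * t).
  by rewrite mulfK.
apply: ler_wpM2l => //; rewrite ler_pdivrMr //; lra.
Qed.

Lemma moment_factor_bound l chi (u : R) K :
  ((\sum_(k <- K) (1 + `|u - k%:~R|) ^+ l * (2 + `|u - k%:~R|)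
       * `|chi (u - k%:~R)|)%:E <= (2 ^+ l / 2)%:E * moment_factor l chi)%E.
Proof.
pose S (m : nat) := \sum_(k <- K) `|u - k%:~R| ^+ m * `|chi (u - k%:~R)|.
have p0 : 0 <= (2 : R) ^+ l / 2 by rewrite divr_ge0 // exprn_ge0.
apply: (@le_trans _ _ ((2 ^+ l / 2) * (S l.+1 + 2 * S l + S 1%N + 2 * S 0%N))%:E).
  rewrite lee_fin /S !mulr_sumr -!big_split /= mulr_sumr.
  apply: ler_sum => k _; set t := `|u - _|; set x := `|chi _|.
  have t0 : 0 <= t by exact: normr_ge0.
  have x0 : 0 <= x by exact: normr_ge0.
  have -> : 2 ^+ l / 2 * (t ^+ l.+1 * x + 2 * (t ^+ l * x) + t ^+ 1 * x + 2 * (t ^+ 0 * x)) =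
     (2 ^+ l / 2 * (1 + t ^+ l)) * (2 + t) * x.
     by rewrite exprS expr1 expr0; ring.
  apply: ler_wpM2r => //; apply: ler_wpM2r; first by rewrite addr_ge0.
  exact: exprD1_le.
rewrite EFinM; apply: lee_wpmul2l; first by rewrite lee_fin.
rewrite !EFinD !EFinM /moment_factor.
apply: leeD; first apply: leeD; first apply: leeD.
- exact: le_abs_moment.
- by apply: lee_wpmul2l; [rewrite lee_fin|exact: le_abs_moment].
- exact: (@le_abs_moment 1).
- by apply: lee_wpmul2l; [rewrite lee_fin|exact: (@le_abs_moment 0)].
Qed.

(** Also when some [y i] vanish and others are infinite, as [0 * +oo = 0]. *)
Lemma lee_prod_EFin (I : Type) (r : seq I) (x : I -> R) (y : I -> \bar R) :
  (forall i, 0 <= x i) -> (forall i, (x i)%:E <= y i)%E ->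
  ((\prod_(i <- r) x i)%:E <= \prod_(i <- r) y i)%E.
Proof.
move=> x0 xy; elim: r => [|i r IH]; first by rewrite !big_nil.
rewrite !big_cons EFinM; apply: lee_pmul => //; rewrite lee_fin //.
exact: prodr_ge0.
Qed.

End MomentBounds.

Section ErrorBound.
Context {R : realType} {d n : nat} (w : R) (hw : 0 < w).
Local Notation C := (option 'I_d).
Local Notation V := (R * 'rV[R]_d)%type.
Local Notation mindex := (C -> nat).
Local Notation I := (int * {ffun 'I_d -> int})%type.
Local Notation msum := (@msum d n).
Variable chi : C -> R -> R.
Hypothesis chi_derive : forall c l x, (l < n)%N ->
  is_derive x (1 : R) (derive1n l (chi c)) (derive1n l.+1 (chi c) x).
Hypothesis chi_tame : forall c l, (l <= n)%N ->
  tame (fun u => (1 + `|u|) ^+ n * `|derive1n l (chi c) u|).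
Hypothesis chi_sum : forall c u,
  summability.partial_sum (fun k : int => chi c (u - k%:~R)) @ summability.totally --> (1 : R).
Variable D : mindex -> V -> R.
Hypothesis HD : jet n D.
Implicit Types (a b g q : mindex) (z : V).

Definition omega g : \bar R := modulus (D g) w^-1 (fun=> w^-1).

Lemma omega_fin g : msize g = n -> omega g \is a fin_num.
Proof.
move=> gn; have [B HB] := jet_bounded HD gn.
by apply: modulus_fin HB; rewrite invr_gt0.
Qed.

Lemma omega_ge0 g : (0 <= omega g)%E.
Proof. by apply: modulus_ge0; rewrite invr_gt0. Qed.

(** On the cell of [i], [w * `|z_c - xi_c|] is at most
    [1 + `|w * z_c - i_c|]; one such factor per degree comes from the monomial,
    and one more, increased by 1, from the number of steps of the modulus. *)
Lemma cell_taylor_error g (i : I) z : (msize g <= n)%N ->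
  `|D g z - cell_taylor n w D g (idx i) z| <=
  msum (fun a => if (msize a + msize g == n)%N then
    (mfac a)%:R^-1 * (fine (omega (madd a g)) * w^-1 ^+ (n - msize g) *
    \prod_c ((1 + `|w * coord z c - (idx i c)%:~R|) ^+ a c *
       (2 + `|w * coord z c - (idx i c)%:~R|))) else 0).
Proof.
move=> gn; apply: cell_taylor_bound => // xi Hxi.
pose Om b := if msize b == n then
   fine (omega b) * \prod_c (1 + w * `|coord (z - xi) c|) else 0.
have T := @taylor_remainder R d n D HD xi (z - xi) Om g 1 gn.
have zE : xi + 1 *: (z - xi) = z by rewrite scale1r addrC subrK.
rewrite zE expr1n mul1r ler01 lexx in T.
apply: le_trans (T _ isT) _.
  move=> b bn s s01; rewrite /Om bn eqxx; apply: modulus_segment => //.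
  exact: omega_fin.
apply: ler_msum => a; case: eqP => // E.
rewrite ler_wpM2l ?invr_ge0 // /Om msize_madd E eqxx.
have o0 : 0 <= fine (omega (madd a g)) by rewrite fine_ge0 // omega_ge0.
have M := norm_mpow_le hw z a Hxi.
have sa : msize a = (n - msize g)%N by rewrite -E addnK.
rewrite big_split /= mulrCA -mulrA ler_wpM2l // mulrA -sa.
apply: ler_pM => //.
  by apply: prodr_ge0 => c _; rewrite addr_ge0 // mulr_ge0 // ltW.
apply: ler_prod => c _; rewrite addr_ge0 ?mulr_ge0 ?(ltW hw) //=.
by rewrite coordB; have := cell_dist hw z (Hxi c); lra.
Qed.

Definition error_sum b g : \bar R := msum (fun a =>
  if (msize a + msize g == n)%N then
    ((mfac a)%:R^-1)%:E * omega (madd a g) *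
    \prod_c moment_factor (a c) (derive1n (b c) (chi c)) else 0)%E.

Lemma error_sum_ge0 b g : (0 <= error_sum b g)%E.
Proof.
rewrite /error_sum msumE; apply: sume_ge0 => a _; case: ifP => // _.
rewrite !mule_ge0 ?lee_fin ?invr_ge0 ?omega_ge0 //.
by apply: prode_ge0 => c _; exact: moment_factor_ge0.
Qed.

(** Convexity costs a factor [2 ^+ a c / 2] in each direction, hence
    [2 ^+ N / 2 ^+ d.+1] altogether. The moments may be infinite, so the estimate
    is carried out on finite sets of cells. *)
Lemma sk_op_error_bound b g z : (msize b + msize g <= n)%N ->
  (`|sk_op n w chi D b g z - (msize b == 0%N)%:R * D g z|%:E <=
   (w^-1 ^+ (n - msize g) * (2 ^+ (n - msize g) / 2 ^+ d.+1))%:E * error_sum b g)%E.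
Proof.
move=> bgn; set N := (n - msize g)%N; set RHS := (_ * _)%E.
have gn : (msize g <= n)%N by apply: leq_trans bgn; exact: leq_addl.
have c0 : 0 <= w^-1 ^+ N * (2 ^+ N / 2 ^+ d.+1) :> R.
  by rewrite mulr_ge0 ?divr_ge0 ?exprn_ge0 ?invr_ge0 // ltW.
have RHS0 : (0 <= RHS)%E by rewrite mule_ge0 ?lee_fin // error_sum_ge0.
suff H (E : {fset I}) : ((\sum_(i <- E) `|weight w chi b i z| *
     `|D g z - cell_taylor n w D g (idx i) z|)%:E <= RHS)%E.
  clearbody RHS; case: RHS RHS0 H => [r _ H|_ _|]; last 2 first.
  - by rewrite leey.
  - by rewrite leNgt ltNyr.
  rewrite lee_fin; apply: (sk_op_error hw chi_derive chi_tame chi_sum HD bgn) => E.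
  by rewrite -lee_fin.
pose H a (i : I) := \prod_c ((1 + `|w * coord z c - (idx i c)%:~R|) ^+ a c *
  (2 + `|w * coord z c - (idx i c)%:~R|) *
  `|derive1n (b c) (chi c) (w * coord z c - (idx i c)%:~R)|).
apply: (@le_trans _ _ (msum (fun a => if (msize a + msize g == n)%N then
    (mfac a)%:R^-1 * (fine (omega (madd a g)) * w^-1 ^+ N * \sum_(i <- E) H a i) else 0))%:E).
  rewrite lee_fin.
  apply: (@le_trans _ _ (\sum_(i <- E) msum (fun a => if (msize a + msize g == n)%N then
    (mfac a)%:R^-1 * (fine (omega (madd a g)) * w^-1 ^+ N * H a i) else 0))).
    apply: ler_sum => i _.
    apply: le_trans (ler_wpM2l (normr_ge0 _) (cell_taylor_error i z gn)) _.
    rewrite msum_mulr; apply: ler_msum => a; case: eqP => _; last by rewrite mulr0.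
    rewrite mulrCA ler_wpM2l ?invr_ge0 //.
    rewrite /H [in leRHS]big_split /= /weight normr_prod -/N.
    by rewrite mulrC mulrA.
  rewrite exchange_msum; apply: ler_msum => a; case: eqP => _; last by rewrite big1.
  by rewrite !mulr_sumr.
rewrite /RHS /error_sum !msumE -sumEFin ge0_sume_distrr; last first.
  move=> a _; case: ifP => // _.
  rewrite !mule_ge0 ?lee_fin ?invr_ge0 ?omega_ge0 //.
  by apply: prode_ge0 => c _; exact: moment_factor_ge0.
apply: lee_sum => a' _; set a := (fun c => _); case: eqP => [E1|_]; last by rewrite mule0.
have sa : msize a = N by rewrite /N -E1 addnK.
have [K HK] := @lattice_sum_le_prod R d E.
have PB : ((\sum_(i <- E) H a i)%:E <= (2 ^+ N / 2 ^+ d.+1)%:E *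
    \prod_c moment_factor (a c) (derive1n (b c) (chi c)))%E.
  have -> : 2 ^+ N / 2 ^+ d.+1 = \prod_c (2 ^+ a c / 2) :> R.
    rewrite big_split /= prodrXr -/(msize a) sa prodr_const card_option card_ord.
    by rewrite exprVn.
  rewrite -prodEFin -big_split /=.
  pose h c (k : int) := (1 + `|w * coord z c - k%:~R|) ^+ a c *
    (2 + `|w * coord z c - k%:~R|) * `|derive1n (b c) (chi c) (w * coord z c - k%:~R)|.
  have h0 c k : 0 <= h c k by rewrite !mulr_ge0 ?exprn_ge0 ?addr_ge0.
  apply: (@le_trans _ _ (\prod_c \sum_(k <- K) h c k)%:E); first by rewrite lee_fin HK.
  apply: lee_prod_EFin => c; first by apply: sumr_ge0.
  exact: moment_factor_bound.
have o0 : 0 <= fine (omega (madd a g)) by rewrite fine_ge0 // omega_ge0.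
rewrite -[omega _]fineK; last by apply: omega_fin; rewrite msize_madd.
have -> : (mfac a)%:R^-1 * (fine (omega (madd a g)) * w^-1 ^+ N * (\sum_(i <- E) H a i)) =
  w^-1 ^+ N * ((mfac a)%:R^-1 * fine (omega (madd a g))) * \sum_(i <- E) H a i by ring.
rewrite EFinM.
apply: le_trans (lee_wpmul2l _ PB) _.
  by rewrite lee_fin !mulr_ge0 ?exprn_ge0 ?invr_ge0 // ltW.
rewrite le_eqVlt; apply/orP; left; apply/eqP.
rewrite !muleA -!EFinM; congr (_%:E * _)%E; ring.
Qed.

Lemma msize_msub q b : mbin q b != 0%N -> (msize b + msize (msub q b) = msize q)%N.
Proof.
move=> /mbin_neq0 bq; rewrite -msize_madd; congr msize.
by apply/funext => c; rewrite /madd /msub subnKC.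
Qed.

(** The term [D q z] is the main term of [b = 0], the only index for which the
    weights have a nonzero sum. The powers of [w] combine because
    [n - msize (msub q b) = (n - msize q) + msize b]. *)
Lemma leibniz_error q z : (msize q <= n)%N ->
  (`|leibniz n w chi D q z - D q z|%:E <=
   (w^-1 ^+ (n - msize q))%:E * msum (fun b => if mbin q b == 0%N then 0 else
     ((mbin q b)%:R * (2 ^+ (n - msize (msub q b)) / 2 ^+ d.+1))%:E *
     error_sum b (msub q b)))%E.
Proof.
move=> qn.
pose X b := sk_op n w chi D b (msub q b) z - (msize b == 0%N)%:R * D (msub q b) z.
have -> : leibniz n w chi D q z - D q z =
    msum (fun b => (mbin q b)%:R * w ^+ msize b * X b).
  have -> : D q z = msum (fun b => if msize b == 0%N then
      (mbin q b)%:R * w ^+ msize b * D (msub q b) z else 0).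
    rewrite msum_pick0 msize_mzero expr0 mulr1 /mbin big1 => [|c _]; last by rewrite bin0.
    by rewrite mul1r; congr (D _ _); apply/funext => c; rewrite /msub subn0.
  rewrite /leibniz -msumN -msumD; apply: eq_msum => b _; rewrite /X.
  by case: eqP => _; rewrite ?mul1r ?mul0r ?oppr0 ?subr0 ?addr0 // mulrBr.
apply: (@le_trans _ _ (msum (fun b => `|(mbin q b)%:R * w ^+ msize b * X b|))%:E).
  by rewrite lee_fin; exact: ler_norm_msum.
rewrite !msumE -sumEFin ge0_sume_distrr; last first.
  move=> b _; case: ifP => // _; apply: mule_ge0; last exact: error_sum_ge0.
  by rewrite lee_fin mulr_ge0 // divr_ge0 // exprn_ge0.
apply: lee_sum => b' _; set b := (fun c => _).
case: eqP => [->|/eqP b0]; first by rewrite !mul0r normr0 mule0.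
have qb := msize_msub b0.
rewrite normrM EFinM ger0_norm; last by rewrite mulr_ge0 // exprn_ge0 // ltW.
have bgn : (msize b + msize (msub q b) <= n)%N by rewrite qb.
apply: le_trans (lee_wpmul2l _ (sk_op_error_bound z bgn)) _.
  by rewrite lee_fin mulr_ge0 // exprn_ge0 // ltW.
rewrite !muleA -!EFinM le_eqVlt; apply/orP; left; apply/eqP; congr (_%:E * _)%E.
have -> : (n - msize (msub q b) = (n - msize q) + msize b)%N by lia.
have W : w ^+ msize b * w^-1 ^+ msize b = 1.
  by rewrite -exprMn mulfV ?expr1n // gt_eqF.
rewrite [w^-1 ^+ (_ + _)]exprD.
set T := 2 ^+ _ / _.
have -> : (mbin q b)%:R * w ^+ msize b * (w^-1 ^+ (n - msize q) * w^-1 ^+ msize b * T) =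
  w^-1 ^+ (n - msize q) * ((mbin q b)%:R * T) * (w ^+ msize b * w^-1 ^+ msize b) by ring.
by rewrite W mulr1.
Qed.

End ErrorBound.

(** * The operator in terms of jets *)

Section Identification.
Context {R : realType} {d n : nat}.
Local Notation C := (option 'I_d).
Local Notation V := (R * 'rV[R]_d)%type.
Implicit Types (g : R -> R) (f : V -> R).

Lemma is_derive_derive1n g l x : in_Cbn n g -> (l < n)%N ->
  is_derive x (1 : R) (derive1n l g) (derive1n l.+1 g x).
Proof.
move=> [H _] ln; rewrite derive1nS derive1E; exact/derivableP/H.
Qed.

Lemma derive1n_tame g l : in_Cbn n g -> kernel_of_order n g ->
  (forall l, (1 <= l <= n)%N -> unif_moment_series n (derive1n l g)) ->
  (l <= n)%N -> tame (fun u => (1 + `|u|) ^+ n * `|derive1n l g u|).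
Proof.
move=> [_ H] [_ K _] U ln; apply: unif_moment_tame; first by case: (H l ln).
by case: l ln => [//|l] ln; apply: U.
Qed.

Definition kernels (phi : R -> R) (psi : 'I_d -> R -> R) (c : C) : R -> R :=
  if c is Some i then psi i else phi.

Lemma msize_mindex_of l (j : 'I_d -> nat) :
  msize (mindex_of l j) = (l + \sum_(i < d) j i)%N.
Proof. by rewrite /msize big_option. Qed.

Lemma mfac_mindex_of l (j : 'I_d -> nat) :
  mfac (mindex_of l j) = (l`! * mfact j)%N.
Proof. by rewrite /mfac big_option. Qed.

Lemma msize_count_mem (s : seq C) : msize (fun c => count_mem c s) = size s.
Proof.
elim: s => [|x s IH]; first by rewrite /msize big1.
rewrite [RHS]/= -IH -(msize_minc x); congr msize; apply/funext => c.
by rewrite /minc /= addnC.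
Qed.

Variables (phi : R -> R) (psi : 'I_d -> R -> R) (w : R) (f : V -> R).
Local Notation D := (fun g : C -> nat => partials (mdirs_of g) f).

Lemma hermite_termE z km : hermite_term n phi psi w f z km =
  sk_term n w (kernels phi psi) D mzero mzero km z.
Proof.
rewrite /hermite_term /sk_term /weight big_option; congr (_ * _).
rewrite /cell_taylor /msum; apply: eq_bigr => l _; rewrite big_mkcond /=.
apply: eq_bigr => j _; rewrite msize_mindex_of msize_mzero addn0; case: ifP => // _.
rewrite mfac_mindex_of natrM div1r -mulrA; congr (_ * _).
rewrite -box_integralE; congr (_ * _); apply: eq_Rintegral => u _.
congr (box_integral _ _ _); apply/funext => v.
rewrite /mpow big_option !coordB -mulrA.
have -> : madd (mindex_of l (fun i => j i : nat)) mzero = mindex_of l (fun i => j i : nat).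
  by apply/funext => c; rewrite /madd addn0.
congr (_ * (_ * _)); apply: eq_bigr => i _; by rewrite coordB.
Qed.

(** For [q = 0] the Leibniz sum has a single nonzero term. *)
Lemma hermite_kantorovichE :
  hermite_kantorovich n phi psi w f = leibniz n w (kernels phi psi) D mzero.
Proof.
apply/funext => z; rewrite /leibniz.
rewrite (@eq_msum _ _ _ _ (fun b => if msize b == 0%N then
   sk_op n w (kernels phi psi) D b (msub mzero b) z else 0)) ?msum_pick0.
  rewrite /sk_op /hermite_kantorovich; congr (summability.sum _).
  by apply/funext => km; rewrite hermite_termE.
move=> b _; case: eqP => [/msize_eq0 ->|b0].
  by rewrite msize_mzero expr0 mulr1 /mbin big1 ?mul1r // => c _; rewrite bin0.
rewrite (_ : mbin mzero b = 0%N) ?mul0r //; apply/eqP/negPn/negP => /mbin_neq0 H.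
by apply: b0; rewrite /msize big1 // => c _; apply/eqP; rewrite -leqn0; exact: H.
Qed.

Hypotheses (hw : 0 < w)
  (chi_derive : forall c l x, (l < n)%N ->
    is_derive x (1 : R) (derive1n l (kernels phi psi c)) (derive1n l.+1 (kernels phi psi c) x))
  (chi_tame : forall c l, (l <= n)%N ->
    tame (fun u => (1 + `|u|) ^+ n * `|derive1n l (kernels phi psi c) u|))
  (f_Cn : in_Cn n f).

(** The list [s] enters the right-hand side only through its multiplicities: the
    iterated derivatives of the operator are symmetric as well. *)
Lemma partials_hermite_kantorovich s : (size s <= n)%N ->
  partials s (hermite_kantorovich n phi psi w f) =
  leibniz n w (kernels phi psi) D (fun c => count_mem c s).
Proof.
elim: s => [|c s IH] sn; first by rewrite hermite_kantorovichE.
rewrite /= IH; last exact: ltnW.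
apply/funext => z.
have cn : (msize (fun c => count_mem c s) < n)%N by rewrite msize_count_mem.
have /@derive_val -> := is_derive_leibniz hw chi_derive chi_tame (jet_mpartial f_Cn) z c cn.
by congr leibniz; apply/funext => c'; rewrite /minc addnC.
Qed.

Lemma has_partials_hermite_kantorovich s : (size s <= n)%N ->
  has_partials s (hermite_kantorovich n phi psi w f).
Proof.
move=> sn c t /suffixP [s' sE] z.
have tn : (size t < n)%N.
  by apply: leq_trans sn; rewrite sE size_cat /= leq_addl.
rewrite partials_hermite_kantorovich; last exact: ltnW.
have cn : (msize (fun c => count_mem c t) < n)%N by rewrite msize_count_mem.
by have [] := is_derive_leibniz hw chi_derive chi_tame (jet_mpartial f_Cn) z c cn.
Qed.

End Identification.

(** * Simultaneous approximation *)

Section Coefficients.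
Context {R : realType} {d : nat}.

Lemma mbin_mindex_of p a (q b : 'I_d -> nat) :
  mbin (mindex_of p q) (mindex_of a b) = ('C(p, a) * \prod_(i < d) 'C(q i, b i))%N.
Proof. by rewrite /mbin big_option. Qed.

Lemma mbinomE (q b : 'I_d -> nat) : (forall i, (b i <= q i)%N) ->
  mbinom R q b = (\prod_(i < d) 'C(q i, b i))%N%:R.
Proof.
move=> bq; rewrite /mbinom -natrM; set x := mfact q; set y := (_ * _)%N.
have y0 : y%:R != 0 :> R.
  rewrite pnatr_eq0 -lt0n muln_gt0 /mfact.
  by apply/andP; split; apply: prodn_gt0 => i; exact: fact_gt0.
apply: (mulIf y0); rewrite mulfVK // -natrM; congr _%:R.
rewrite /x /y /mfact -!big_split /=; apply: eq_bigr => i _.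
by rewrite bin_fact.
Qed.

Lemma exp2_int_sub (N m : nat) : (2 : R) ^ (N%:Z - m%:Z) = 2 ^+ N / 2 ^+ m.
Proof. by rewrite expfzDr ?pnatr_eq0 // exprnN. Qed.

End Coefficients.

Theorem theorem5 (R : realType) (d n : nat) (hd : (1 <= d)%N)
  (phi : R -> R) (psi : 'I_d -> R -> R)
  (phi_Cbn : in_Cbn n phi) (psi_Cbn : forall i, in_Cbn n (psi i))
  (phi_ker : kernel_of_order n phi)
  (psi_ker : forall i, kernel_of_order n (psi i))
  (phi_unif : forall l, (1 <= l <= n)%N -> unif_moment_series n (derive1n l phi))
  (psi_unif : forall i l, (1 <= l <= n)%N -> unif_moment_series n (derive1n l (psi i)))
  (f : R * 'rV[R]_d -> R) (f_Cn : in_Cn n f)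
  (p : nat) (q : 'I_d -> nat) (hpq : (p + \sum_(i < d) q i <= n)%N)
  (phi_mom : (abs_moment n.+1%:R phi < +oo)%E)
  (psi_mom : forall i, (abs_moment n.+1%:R (psi i) < +oo)%E)
  (w : R) (hw : 0 < w) :
  let Kf := hermite_kantorovich n phi psi w f in
  let N (a : nat) (b : 'I_d -> nat) : nat :=
    (n - (p + \sum_(i < d) q i - a - \sum_(i < d) b i))%N in
  [/\ forall z, summable setT (EFin \o hermite_term n phi psi w f z),
      has_partials (mdirs p q) Kf
    & (sup_norm (fun z => (mpartial p q Kf z - mpartial p q f z)%R) <=
       (1 / w ^+ (n - (p + \sum_(i < d) q i)))%:E *
       \sum_(a < p.+1)
       \sum_(b : {ffun 'I_d -> 'I_n.+1} | [forall i, (b i <= q i)%N])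
         ('C(p, a)%:R * mbinom R q (fun i => b i) * 2 ^ ((N a (fun i => b i))%:Z - d.+1%:Z))%:E *
         \sum_(l < n.+1)
         \sum_(j : {ffun 'I_d -> 'I_n.+1} |
                 (l + \sum_(i < d) j i == N a (fun i => b i))%N)
           (1 / ((l`!)%:R * (mfact (fun i => j i))%:R))%:E *
           modulus (mpartial (l + p - a) (fun i => j i + q i - b i)%N f)
             (1 / w)%R (fun=> 1 / w)%R *
           moment_factor l (derive1n a phi) *
           \prod_(i < d) moment_factor (j i) (derive1n (b i) (psi i)))%E].

Proof.
move=> Kf N.
pose chi := kernels phi psi.
have chi_derive c l x : (l < n)%N ->
    is_derive x (1 : R) (derive1n l (chi c)) (derive1n l.+1 (chi c) x).
  by case: c => [i|] ln; [exact: (is_derive_derive1n _ (psi_Cbn i))|exact: (is_derive_derive1n _ phi_Cbn)].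
have chi_tame c l : (l <= n)%N ->
    tame (fun u => (1 + `|u|) ^+ n * `|derive1n l (chi c) u|).
  case: c => [i|]; last exact: derive1n_tame phi_Cbn phi_ker phi_unif.
  exact: derive1n_tame (psi_Cbn i) (psi_ker i) (psi_unif i).
have chi_sum c u : summability.partial_sum (fun k : int => chi c (u - k%:~R))
    @ summability.totally --> (1 : R).
  by case: c => [i|]; [case: (psi_ker i) => H _ _|case: phi_ker => H _ _]; exact: H.
have HD := jet_mpartial f_Cn.
pose Q := mindex_of p q.
have Qn : (msize Q <= n)%N by rewrite msize_mindex_of.
have sQ : (size (mdirs p q) <= n)%N by rewrite (size_mdirs_of Q).
split.
- move=> z; have -> : hermite_term n phi psi w f z =
      sk_term n w chi (fun g => partials (mdirs_of g) f) mzero mzero ^~ z.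
    by apply/funext => km; exact: hermite_termE.
  apply: abs_summable_summable.
  by apply: (sk_term_summable hw chi_tame HD) => //; rewrite msize_mzero.
- exact: (has_partials_hermite_kantorovich hw chi_derive chi_tame f_Cn).
apply: ge_ereal_sup => _ [z _ <-].
rewrite {1}/mpartial (partials_hermite_kantorovich hw chi_derive chi_tame f_Cn) //.
have -> : (fun c => count_mem c (mdirs p q)) = Q.
  by apply/funext => c; exact: (count_mdirs_of Q).
apply: le_trans (leibniz_error hw chi_derive chi_tame chi_sum HD z Qn) _.
rewrite msize_mindex_of exprVn -[_^-1]div1r le_eqVlt; apply/orP; left; apply/eqP.
congr (_ * _)%E; first by rewrite ?div1r.
rewrite /msum.
(* The sum over [a <= p] is extended to [a <= n], where the binomial coefficient
   vanishes. *)
pose G (a : nat) : \bar R :=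
  (\sum_(b : {ffun 'I_d -> 'I_n.+1} | [forall i, (b i <= q i)%N])
     ('C(p, a)%:R * mbinom R q (fun i => b i) * 2 ^ ((N a (fun i => b i))%:Z - d.+1%:Z))%:E *
     \sum_(l < n.+1)
     \sum_(j : {ffun 'I_d -> 'I_n.+1} |
             (l + \sum_(i < d) j i == N a (fun i => b i))%N)
       (1 / ((l`!)%:R * (mfact (fun i => j i))%:R))%:E *
       modulus (mpartial (l + p - a) (fun i => j i + q i - b i)%N f)
         (1 / w)%R (fun=> 1 / w)%R *
       moment_factor l (derive1n a phi) *
       \prod_(i < d) moment_factor (j i) (derive1n (b i) (psi i)))%E.
transitivity (\sum_(a < p.+1) G a); last by [].
rewrite (big_ord_widen n.+1 G); last first.
  by rewrite ltnS; apply: leq_trans hpq; exact: leq_addr.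
rewrite [RHS]big_mkcond; apply: eq_bigr => a _; rewrite ltnS /G.
case: leqP => [ap|pa]; last first.
  by rewrite big1 // => b _; rewrite mbin_mindex_of bin_small.
rewrite [RHS]big_mkcond; apply: eq_bigr => b _; rewrite mbin_mindex_of.
case: (boolP [forall i, _]) => [/forallP bq|]; last first.
  rewrite negb_forall => /existsP [i]; rewrite -ltnNge => qb.
  have -> : (\prod_(i < d) 'C(q i, b i) = 0)%N by rewrite (bigD1 i) //= bin_small.
  by rewrite muln0.
rewrite ifF; last first.
  apply/negbTE; rewrite -lt0n muln_gt0 bin_gt0 ap /=.
  by apply: prodn_gt0 => i; rewrite bin_gt0.
set be := mindex_of a _.
have QE : msize Q = (p + \sum_(i < d) q i)%N by exact: msize_mindex_of.
have bE : msize be = (a + \sum_(i < d) b i)%N by exact: msize_mindex_of.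
have H : (msize be + msize (msub Q be) = msize Q)%N.
  rewrite -msize_madd; congr msize.
  by apply/funext => -[i|]; rewrite /madd /msub /= subnKC.
have gE : msize (msub Q be) = (p + \sum_(i < d) q i - a - \sum_(i < d) b i)%N.
  by rewrite -subnDA -QE -bE -H addKn.
rewrite natrM mbinomE // exp2_int_sub gE; congr (_ * _)%E.
rewrite /error_sum /msum; apply: eq_bigr => l _.
rewrite [RHS]big_mkcond; apply: eq_bigr => j _.
have -> : (msize (mindex_of l (fun i => j i : nat)) + msize (msub Q be) == n)%N =
    (l + \sum_(i < d) j i == N a (fun i => b i))%N.
  have gn : (msize (msub Q be) <= n)%N by apply: leq_trans Qn; rewrite -H leq_addl.
  by rewrite /N -gE msize_mindex_of -[in RHS](eqn_add2r (msize (msub Q be))) subnK.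
case: ifP => // _.
rewrite mfac_mindex_of natrM !div1r /omega big_option muleA.
congr (_ * modulus _ _ _ * _ * _)%E.
rewrite /mpartial /mdirs_of; congr (partials (mdirs _ _) f).
  by rewrite /madd /msub /= addnBA.
by apply/funext => i; rewrite /madd /msub /= addnBA.
Qed.
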